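(* Let $\gamma_a,\gamma_s,\kappa_a,\kappa_s,\sigma_B,\varepsilon_a>0$, $\lambda\ge 0$. Let $\beta_a,\beta_s\in W^{1,\infty}(\mathbb R)$ be nondecreasing. Let $q\in C^{\theta_0}(I)\cap L^\infty(I)$ for some $\theta_0\in(0,1)$, $q\ge0$, and let $r$ be positive, bounded and globally Lipschitz on $(0,+\infty)$. Let $\mathbf T^0\in\mathbf D(\mathbf A)_+$ and let $\mathbf T$ be the associated strict solution of $\mathbf T'(t)=\mathbf A\mathbf T(t)+\mathbf G(t,\mathbf T(t))$, $\mathbf T(0)=\mathbf T^0$, maximally defined on $[0,\mathcal T^*(\mathbf T^0))$. If $\mathbf T^+$ is a super-solution defined on $[0,\mathcal T^+)$, then $$\mathbf T^0\le\mathbf T^+(0)\ \implies\ \mathbf T(t,x)\le\mathbf T^+(t,x)\quad\text{for all }(t,x)\in\big([0,\mathcal T^*(\mathbf T^0))\cap[0,\mathcal T^+)\big)\times I.$$ Similarly, if $\mathbf T^-$ is a sub-solution defined on $[0,\mathcal T^-)$, then $$\mathbf T^0\ge\mathbf T^-(0)\ \implies\ \mathbf T(t,x)\ge\mathbf T^-(t,x)\quad\text{for all }(t,x)\in\big([0,\mathcal T^*(\mathbf T^0))\cap[0,\mathcal T^-)\big)\times I.$$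
   Context: Let $I=(-1,1)$, $\rho(x)=1-x^2$, $H=L^2(I)$, $V=\{u\in H: u \text{ locally absolutely continuous in } I,\ \sqrt{\rho}\,u'\in L^2(I)\}$ with norm $\|u\|_V^2=\|u\|_{L^2(I)}^2+\|\sqrt\rho\,u'\|_{L^2(I)}^2$, and $D(A)=\{u\in H: u\text{ locally absolutely continuous in } I,\ \rho u'\in H^1_0(I)\}$, $Au=(\rho u')'$. The operator $A$ is self-adjoint and dissipative on $H$ and generates an analytic semigroup of contractions. Set $\mathbf H=H\times H$, $\mathbf V=V\times V$, $\mathbf D(\mathbf A)=D(A)\times D(A)$ with the graph norm, $\mathbf A(u_a,u_s)=(\kappa_aAu_a,\kappa_sAu_s)$. Inequalities between vectors are component-wise; $\mathbf D(\mathbf A)_+=\{\mathbf u\in\mathbf D(\mathbf A):\mathbf u\ge\mathbf 0\}$. The map $\mathbf G:[0,+\infty)\times\mathbf V\to\mathbf H$ is $$\mathbf G(t,(u_a,u_s))=\begin{pmatrix}\frac1{\gamma_a}\left[-\lambda(u_a-u_s)+\varepsilon_a\sigma_B|u_s|^3u_s-2\varepsilon_a\sigma_B|u_a|^3u_a+r(t)\,q\,\beta_a(u_a)\right]\\ \frac1{\gamma_s}\left[-\lambda(u_s-u_a)-\sigma_B|u_s|^3u_s+\varepsilon_a\sigma_B|u_a|^3u_a+r(t)\,q\,\beta_s(u_s)\right]\end{pmatrix}$$ (with $r(0)$ the continuous extension of $r$). A strict solution on $[0,\mathcal T]$ is a function $\mathbf T\in C^1([0,\mathcal T];\mathbf H)\cap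 C([0,\mathcal T];\mathbf D(\mathbf A))$ satisfying the equation for every $t\in[0,\mathcal T]$ and the initial condition; for $\mathbf T^0\in\mathbf D(\mathbf A)$ there is a unique maximal one, on $[0,\mathcal T^*(\mathbf T^0))$ (it is also the maximal mild solution). A super-solution on $[0,\mathcal T^+)$, $\mathcal T^+>0$, is a function $\mathbf T^+=(T_a^+,T_s^+)\in C^1([0,\mathcal T^+);\mathbf H)\cap C([0,\mathcal T^+);\mathbf D(\mathbf A))$ such that on $[0,\mathcal T^+)\times I$ $$\gamma_a\left[\partial_tT_a^+-\kappa_a\partial_x\big((1-x^2)\partial_xT_a^+\big)\right]\ge-\lambda(T_a^+-T_s^+)+\varepsilon_a\sigma_B|T_s^+|^3T_s^+-2\varepsilon_a\sigma_B|T_a^+|^3T_a^++r(t)q(x)\beta_a(T_a^+),$$ $$\gamma_s\left[\partial_tT_s^+-\kappa_s\partial_x\big((1-x^2)\partial_xT_s^+\big)\right]\ge-\lambda(T_s^+-T_a^+)-\sigma_B|T_s^+|^3T_s^++\varepsilon_a\sigma_B|T_a^+|^3T_a^++r(t)q(x)\beta_s(T_s^+).$$ A sub-solution $\mathbf T^-$ on $[0,\mathcal T^-)$ is defined with the same regularity and the reverse inequalities. *)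

(* Defs.v *)
From HB Require Import structures.
From mathcomp Require Import all_boot all_order all_algebra.
From mathcomp Require Import all_classical all_reals all_analysis.

Set Implicit Arguments.
Unset Strict Implicit.
Unset Printing Implicit Defensive.

Import Order.TTheory GRing.Theory Num.Theory.
Import numFieldNormedType.Exports.
Local Open Scope classical_set_scope.
Local Open Scope ring_scope.

(* Elements of L^p(D) are represented by functions R -> R, only their values on
   D being relevant: a function f is identified with its extension f \_ D by
   zero, and equality in L^p(D) is equality almost everywhere on D.  Operators
   with values in such a space (wderiv, Aop, tderiv) pick a representative by
   [get]; they are meaningful, up to null sets, where the picked object exists
   (in W^{1,p}, in D(A), for C^1 functions of time). *)

Section Spaces.
Context {R : realType}.
Implicit Types (D : set R) (p : \bar R) (u v g phi : R -> R).

Definition mem_Lp D p u : Prop := u \_ D \in Lfun lebesgue_measure p.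

Definition Lp_norm D p u : \bar R :=
  Lnorm lebesgue_measure p (EFin \o (u \_ D)).

Definition ae_eq_on D u v : Prop :=
  {ae lebesgue_measure, forall x, D x -> u x = v x}.

Definition ae_le_on D u v : Prop :=
  {ae lebesgue_measure, forall x, D x -> u x <= v x}.

(* C^1_c(D): as in Brezis (Functional Analysis, Sobolev Spaces and PDEs, ch. 8),
   weak derivatives and W^{1,p}_0 in one dimension are based on C^1 test
   functions. *)
Definition test_fun D phi : Prop :=
  [/\ forall x, derivable phi x 1, continuous (derive1 phi) &
      exists K, [/\ compact K, K `<=` D & forall x, ~ K x -> phi x = 0]].

Definition is_wderiv D u g : Prop :=
  forall phi, test_fun D phi ->
    \int[lebesgue_measure]_(x in D) (u x * derive1 phi x) =
    - \int[lebesgue_measure]_(x in D) (g x * phi x).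

Definition wderiv D p u : R -> R :=
  get [set g | mem_Lp D p g /\ is_wderiv D u g].

Definition W1p D p u : Prop :=
  mem_Lp D p u /\ exists g, mem_Lp D p g /\ is_wderiv D u g.

(* closure of C^1_c(D) for the norm ||w||_p + ||w'||_p of W^{1,p}(D) *)
Definition W1p0 D p u : Prop :=
  W1p D p u /\
  forall e : R, 0 < e -> exists2 phi, test_fun D phi &
    (Lp_norm D p (fun x => (u x - phi x)%R) +
     Lp_norm D p (fun x => (wderiv D p u x - derive1 phi x)%R) < e%:E)%E.

Definition abs_cont (a b : R) u : Prop :=
  forall e : R, 0 < e -> exists2 d : R, 0 < d &
    forall (n : nat) (s t : 'I_n -> R),
      (forall i, a <= s i <= t i /\ t i <= b) ->
      trivIset setT (fun i => `]s i, t i[%classic) ->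
      \sum_(i < n) (t i - s i) < d ->
      \sum_(i < n) `|u (t i) - u (s i)| < e.

Definition loc_abs_cont D u : Prop :=
  forall a b, a <= b -> `[a, b] `<=` D -> abs_cont a b u.

(* C^theta(D) for open D: the Hoelder constant may depend on the compact
   subset of D, so that C^theta(D) does not entail boundedness *)
Definition loc_hoelder D (theta : R) u : Prop :=
  forall K, compact K -> K `<=` D ->
    exists C : R, forall x y, K x -> K y ->
      `|u x - u y| <= C * (`|x - y| `^ theta).

End Spaces.

Section Operator.
Context {R : realType}.
Implicit Types (u : R -> R) (U : R -> R -> R) (J : set R).

Definition intI : set R := `]-1, 1[%classic.

Definition rho (x : R) : R := 1 - x ^+ 2.

Definition memH u : Prop := mem_Lp intI 2%:E u.
Definition normH u : \bar R := Lp_norm intI 2%:E u.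

(* u' is the pointwise (a.e. existing) derivative of u *)
Definition mem_DA u : Prop :=
  [/\ memH u, loc_abs_cont intI u & W1p0 intI 2%:E (fun x => rho x * derive1 u x)].

Definition Aop u : R -> R := wderiv intI 2%:E (fun x => rho x * derive1 u x).

(* Below, U : R -> R -> R is a function of time, then space, and J is the time
   interval; limits are taken within J. *)

Definition contH J U : Prop :=
  forall t, J t -> memH (U t) /\
    normH (fun x => U s x - U t x) @[s --> within J (nbhs t)] --> 0%E.

Definition is_tderiv J U (t : R) (v : R -> R) : Prop :=
  memH v /\
  normH (fun x => (s - t)^-1 * (U s x - U t x) - v x)
    @[s --> within J t^'] --> 0%E.

Definition tderiv J U (t : R) : R -> R := get [set v | is_tderiv J U t v].

Definition C1H J U : Prop :=
  (forall t, J t -> memH (U t) /\ exists v, is_tderiv J U t v) /\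
  contH J (tderiv J U).

(* continuity for the graph norm of A *)
Definition contDA J U : Prop :=
  [/\ forall t, J t -> mem_DA (U t), contH J U &
      contH J (fun t => Aop (U t))].

End Operator.

Record ebm_data (R : realType) := EbmData {
  gamma_a : R; gamma_s : R;
  kappa_a : R; kappa_s : R;
  sigma_B : R; eps_a : R; lambda : R;
  beta_a : R -> R; beta_s : R -> R;
  q : R -> R;
  r : R -> R
}.

Section Problem.
Context {R : realType} (P : ebm_data R).
Notation field := (R -> R).
Implicit Types (u : field * field) (T : R -> field * field) (J : set R).

(* r is a function on (0,+oo), extended to 0 by its limit *)
Definition r_ext (t : R) : R :=
  if 0 < t then r P t else lim (r P s @[s --> 0^'+]).

(* the brackets in the two components of G *)
Definition bracket_a (t : R) u (x : R) : R :=
  - lambda P * (u.1 x - u.2 x)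
  + eps_a P * sigma_B P * `|u.2 x| ^+ 3 * u.2 x
  - 2 * eps_a P * sigma_B P * `|u.1 x| ^+ 3 * u.1 x
  + r_ext t * q P x * beta_a P (u.1 x).

Definition bracket_s (t : R) u (x : R) : R :=
  - lambda P * (u.2 x - u.1 x)
  - sigma_B P * `|u.2 x| ^+ 3 * u.2 x
  + eps_a P * sigma_B P * `|u.1 x| ^+ 3 * u.1 x
  + r_ext t * q P x * beta_s P (u.2 x).

Definition G (t : R) u : field * field :=
  (fun x => (gamma_a P)^-1 * bracket_a t u x,
   fun x => (gamma_s P)^-1 * bracket_s t u x).

Definition bA u : field * field :=
  (fun x => kappa_a P * Aop u.1 x, fun x => kappa_s P * Aop u.2 x).

Definition bmem_DA u : Prop := mem_DA u.1 /\ mem_DA u.2.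

Definition beq u v : Prop := ae_eq_on intI u.1 v.1 /\ ae_eq_on intI u.2 v.2.
Definition ble u v : Prop := ae_le_on intI u.1 v.1 /\ ae_le_on intI u.2 v.2.

Definition fst_c T : R -> field := fun t => (T t).1.
Definition snd_c T : R -> field := fun t => (T t).2.

(* C^1(J; H x H) /\ C(J; D(A) x D(A)) *)
Definition regular J T : Prop :=
  [/\ C1H J (fst_c T), C1H J (snd_c T),
      contDA J (fst_c T) & contDA J (snd_c T)].

Definition btderiv J T (t : R) : field * field :=
  (tderiv J (fst_c T) t, tderiv J (snd_c T) t).

Definition strict_solution J (T0 : field * field) T : Prop :=
  [/\ regular J T,
      forall t, J t ->
        beq (btderiv J T t)
            (fun x => (bA (T t)).1 x + (G t (T t)).1 x,
             fun x => (bA (T t)).2 x + (G t (T t)).2 x) &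
      beq (T 0) T0].

(* [0, b) with b possibly +oo *)
Definition tint (b : \bar R) : set R := [set t | 0 <= t /\ (t%:E < b)%E].

(* strict solution on [0, b) (i.e. on [0, tau] for every tau < b) without any
   proper extension *)
Definition maximal_strict_solution (b : \bar R) (T0 : field * field) T : Prop :=
  [/\ (0 < b)%E, strict_solution (tint b) T0 T &
      forall (b' : \bar R) S,
        (b <= b')%E -> strict_solution (tint b') T0 S ->
        (forall t, tint b t -> beq (S t) (T t)) -> b' = b].

(* The differential inequalities are between elements of H, hence hold for
   every time and almost every x. *)
Definition super_solution (b : \bar R) T : Prop :=
  [/\ (0 < b)%E, regular (tint b) T &
      forall t, tint b t ->
        ae_le_on intI (bracket_a t (T t))
          (fun x => gamma_a P * ((btderiv (tint b) T t).1 x - (bA (T t)).1 x))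
        /\
        ae_le_on intI (bracket_s t (T t))
          (fun x => gamma_s P * ((btderiv (tint b) T t).2 x - (bA (T t)).2 x))].

Definition sub_solution (b : \bar R) T : Prop :=
  [/\ (0 < b)%E, regular (tint b) T &
      forall t, tint b t ->
        ae_le_on intI
          (fun x => gamma_a P * ((btderiv (tint b) T t).1 x - (bA (T t)).1 x))
          (bracket_a t (T t))
        /\
        ae_le_on intI
          (fun x => gamma_s P * ((btderiv (tint b) T t).2 x - (bA (T t)).2 x))
          (bracket_s t (T t))].

End Problem.

(* Main.v *)
From HB Require Import structures.
Require Import Defs.
From mathcomp Require Import all_boot all_order all_algebra.
From mathcomp Require Import all_classical all_reals all_analysis.
From mathcomp Require Import measurable_realfun ess_sup_inf ring lra.

(** Let X be a sub-solution and Y a super-solution with X(0) <= Y(0), and write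
w = X - Y componentwise and z^+ for the positive part.  The comparison X <= Y
follows from a Gronwall inequality for
  E(t) = gamma_a * int (w_a^+)^3 + gamma_s * int (w_s^+)^3.
Differentiating in time [energy_is_derive] gives
  E' = 3 * int [gamma_a (w_a^+)^2 dt w_a + gamma_s (w_s^+)^2 dt w_s],
and the two differential inequalities bound gamma * dt w by
gamma * kappa * A w plus the difference of the reaction terms.

- Diffusion: int (w^+)^2 A w = - 2 int rho w^+ (w')^2 <= 0 [dom_dissipative].
- Reaction: each bracket is nondecreasing in the other unknown, and in its own
  unknown only the term r q beta increases.  As beta is Lipschitz
  [nondecreasing_W1py_lipschitz] and the curves are bounded, the reaction
  contributes at most C * int [(w_a^+)^3 + (w_s^+)^3] [reaction_cooperative].

Hence E' <= K E with E(0) = 0, so E = 0 and w <= 0 almost everywhere, and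
everywhere because elements of D(A) are continuous on I.  A strict solution is
both a sub-solution and a super-solution, which gives the two statements.

The cube is chosen so that the multiplier (w^+)^2 is C^1: the integration by
parts then concerns C^1 functions only.

What remains is regularity.  For u in D(A), put g = Au.  Being in H^1_0 means
that g is a limit of derivatives of test functions, so that rho u' is almost
everywhere the primitive P of g, and Cauchy-Schwarz from the nearer end point
yields |P(x)| <= ||g|| sqrt(1 - |x|) [le_prim].  The local absolute continuity
of u turns u' = P / rho almost everywhere into a pointwise derivative
[abs_cont_is_derive].  Since |u'| is at most ||g|| / sqrt(1 - x^2), with primitive
the bounded function ||g|| asin, u is bounded by a multiple of its graph norm
[dom_bounded]; the decay of P makes the boundary terms of the integration by
parts vanish.  Continuity in D(A) then bounds a regular curve uniformly on
compact time intervals.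

Absolute continuity enters through the fundamental theorem of calculus
[abs_cont_density], obtained from the Radon-Nikodym theorem applied to the
Lebesgue-Stieltjes measures of the two nondecreasing parts of the Jordan
decomposition. *)

Import Order.TTheory GRing.Theory Num.Theory.
Import numFieldNormedType.Exports.
Local Open Scope classical_set_scope.
Local Open Scope ring_scope.
Set Implicit Arguments.
Unset Strict Implicit.
Unset Printing Implicit Defensive.

(** * The density of a nondecreasing absolutely continuous function *)

Section stieltjes_density.
Context {R : realType}.
Implicit Types F : R -> R.
Local Notation mu := (@lebesgue_measure R).

(** Absolute continuity on the whole line: Lebesgue-Stieltjes measures live there. *)
Definition abs_contT F := forall e : R, 0 < e -> exists2 d : R, 0 < d &
    forall (n : nat) (s t : 'I_n -> R),
      (forall i, s i <= t i) ->
      trivIset setT (fun i => `]s i, t i[%classic) ->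
      \sum_(i < n) (t i - s i) < d ->
      \sum_(i < n) `|F (t i) - F (s i)| < e.

Lemma abs_contT_continuous F : abs_contT F -> continuous F.
Proof.
move=> ac x; apply/cvgrPdist_lt => e e0.
have [d d0 dP] := ac _ e0.
apply/nbhs_ballP; exists d => //= y; rewrite /ball/=.
wlog xy : x y / x <= y.
  move=> H yx; have [xy|/ltW yx'] := leP x y; first exact: H.
  by rewrite distrC; apply: H => //; rewrite distrC.
move=> yx; have := dP 1%N (fun=> x) (fun=> y).
rewrite !big_ord_recl !big_ord0 !addr0 (distrC (F x)); apply => //.
  by move=> i j _ _ _; rewrite (ord1 i) (ord1 j).
by rewrite -(ger0_norm (_ : 0 <= y - x)) ?subr_ge0// distrC.
Qed.

(** The intervals that make up an open set of finite measure may be replaced by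
bounded ones with explicit end points, as absolute continuity requires. *)
Lemma finite_interval (J : set R) : is_interval J -> (mu J < +oo)%E ->
  exists st : R * R,
    [/\ st.1 <= st.2, `]st.1, st.2[ `<=` J & J `<=` `[st.1, st.2]].
Proof.
move=> /is_intervalP ->; case: (Rhull J) => a b muJ.
have [J0|] := eqVneq [set` Interval a b] set0.
  by exists (0, 0); rewrite J0/= set_itv_ge ?bnd_simp ?ltxx//; split.
move=> /set0P[x]/=.
case: a b muJ => [ba a|[|]] [bb b|[|]];
  rewrite lebesgue_measure_itv//= ?ltxx ?ltNyr ?ltry// => _.
  rewrite in_itv/= => /andP[ax xb].
  exists (a, b); split=> /=; first exact: le_trans (lteifW ax) (lteifW xb).
    by move=> z/=; rewrite !in_itv/= => /andP[/lteifS -> /lteifS ->].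
  by move=> z/=; rewrite !in_itv/= => /andP[/lteifW -> /lteifW ->].
all: by rewrite in_itv/= ?andbF.
Qed.

Section density.
Variable F : R -> R.
Hypothesis ndF : {homo F : x y / x <= y}.
Hypothesis acF : abs_contT F.

Let rcF : right_continuous F.
Proof. exact/right_continuousW/abs_contT_continuous. Qed.

HB.instance Definition _ := isCumulative.Build R _ R F ndF rcF.

Let nu : measure _ R := lebesgue_stieltjes_measure F.

Let nu_oc x y : x <= y -> nu `]x, y]%classic = (F y - F x)%:E.
Proof.
move=> xy; rewrite /nu/= /lebesgue_stieltjes_measure /measure_extension.
rewrite measurable_mu_extE/=; last exact: is_ocitv.
by rewrite wlength_itv_bnd.
Qed.

(** Continuity of F excludes an atom at x. *)
Let nu_cc x y : x <= y -> nu `[x, y]%classic = (F y - F x)%:E.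
Proof.
move=> xy; apply/eqP; rewrite eq_le; apply/andP; split; last first.
  rewrite -nu_oc//; apply: le_measure; rewrite ?inE//.
  by apply: subset_itvr; rewrite bnd_simp.
apply/lee_addgt0Pr => e e0.
have /cvgrPdist_lt/(_ _ e0)/nbhs_ballP[d /= d0 dP] := @abs_contT_continuous F acF x.
have dx : F x - F (x - d / 2) <= e.
  apply/ltW/(le_lt_trans (ler_norm _)); apply: dP; rewrite /ball/=.
  by rewrite opprB addrC subrK gtr0_norm ?divr_gt0// ltr_pdivrMr// ltr_pMr// ltr1n.
have xd : x - d / 2 < x by rewrite ltrBlDr ltrDl divr_gt0.
rewrite (@le_trans _ _ (nu `]x - d / 2, y]%classic))//.
  apply: le_measure; rewrite ?inE//.
  by apply: subset_itvr; rewrite bnd_simp.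
rewrite nu_oc ?(le_trans (ltW xd))// -EFinD lee_fin.
by lra.
Qed.

(** A null set is covered by an open set U of small Lebesgue measure; absolute
continuity bounds the increments of F over the components of U, which sum up to
the Stieltjes measure of U. *)
Let nu_dominated : nu `<< mu.
Proof.
apply/null_content_dominatesP => N mN N0.
apply/eqP; rewrite eq_le measure_ge0 andbT.
apply/lee_addgt0Pr => e e0; rewrite add0e.
have [d d0 dP] := acF e0.
have d20 : 0 < d / 2 by rewrite divr_gt0.
have [U [oU NU Ud]] := outer_measure_open_le N d20.
have {}Ud : (mu U < d%:E)%E.
  apply: (le_lt_trans Ud).
  have nN : mu.-negligible N by exists N; split.
  rewrite ((negligible_outer_measure N).1 nN).
  by rewrite add0e lte_fin ltr_pdivrMr// ltr_pMr// ltr1n.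
rewrite (@le_trans _ _ (nu U))//.
  by apply: le_measure; rewrite ?inE//; exact: open_measurable.
pose J := open_disjoint_itv oU.
have UJ : U = \bigcup_n J n by exact: open_disjoint_itv_bigcup.
have mJ n : measurable (J n).
  by apply: open_measurable; exact: open_disjoint_itv_open.
have mU : measurable U by exact: open_measurable.
have JU n : J n `<=` U by rewrite UJ; exact: bigcup_sup.
have tJ : trivIset setT J by exact: open_disjoint_itv_trivIset.
have muJ n : (mu (J n) < +oo)%E.
  rewrite (@le_lt_trans _ _ (mu U))//; last by rewrite (lt_trans Ud) ?ltry.
  by apply: le_measure; rewrite ?inE//; first exact: mJ; exact: JU.
have /choice[st stP] n := finite_interval (@open_disjoint_itv_is_interval _ _ oU n) (muJ n).
rewrite UJ measure_semi_bigcup//; last by rewrite -UJ.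
apply: lime_le.
  by apply: is_cvg_nneseries => n _ _; exact: measure_ge0.
apply: nearW => n; rewrite big_mkord.
have nuJ i : (nu (J i) <= `|F (st i).2 - F (st i).1|%:E)%E.
  have [st12 _ Jst] := stP i.
  rewrite ger0_norm ?subr_ge0 ?ndF// -nu_cc//.
  by apply: le_measure; rewrite ?inE//; exact: mJ.
rewrite (le_trans (lee_sum _ (fun (i : 'I_n) _ => nuJ i)))// sumEFin lee_fin.
apply/ltW/(dP n (fun i => (st i).1) (fun i => (st i).2)).
- by move=> i; case: (stP i).
- move=> i j _ _ [x [xi xj]]; apply/val_inj/(tJ i j) => //; exists x.
  by split; [case: (stP i) => _ + _; exact|case: (stP j) => _ + _; exact].
- rewrite -lte_fin -sumEFin (le_lt_trans _ Ud)//.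
  rewrite (@le_trans _ _ (\sum_(i < n) mu (J i))%E)//.
    apply: lee_sum => i _; have [st12 stJ _] := stP i.
    have <- : mu `](st i).1, (st i).2[%classic = ((st i).2 - (st i).1)%:E.
      rewrite lebesgue_measure_itv/= lte_fin.
      case: ltgtP st12 => // ->; by rewrite subrr.
    by apply: le_measure; rewrite ?inE//; exact: mJ.
  rewrite -(@measure_semi_additive_ord _ _ _ mu n (fun i : 'I_n => J i)).
  - apply: le_measure; rewrite ?inE//; first by apply: bigsetU_measurable => k _; exact: mJ.
    by rewrite -bigcup_mkord => x [i _ /JU].
  - by move=> k; exact: mJ.
  - by move=> i j _ _ ij; apply/val_inj/(tJ i j).
  - by apply: bigsetU_measurable => k _; exact: mJ.
Qed.

Hypothesis bF : exists AB : R * R, forall x, AB.1 <= F x <= AB.2.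

Let nu_setT : (nu setT < +oo)%E.
Proof.
have [[A B] /= AB] := bF.
rewrite -(bigcup_itvT false false).
pose I n : set R := `]- (n%:R), n%:R]%classic.
have ndI : nondecreasing_seq I.
  by move=> *; apply/subsetPset/subset_itv; rewrite leBSide/= ?lerN2 ler_nat.
have cI : (nu \o I) n @[n --> \oo] --> nu (\bigcup_n I n).
  have mI n : measurable (I n) by exact: measurable_itv.
  apply: nondecreasing_cvg_mu; [exact: mI| |exact: ndI].
  by apply: bigcup_measurable => n _; exact: mI.
change (nu (\bigcup_n I n) < +oo)%E.
rewrite (@le_lt_trans _ _ (B - A)%:E) ?ltry//.
rewrite -(cvg_lim _ cI)//; apply: lime_le; first by apply/cvg_ex; eexists; exact: cI.
apply: nearW => n /=; rewrite /I nu_oc ?ge0_cp// lee_fin.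
by have := AB n%:R; have := AB (- n%:R); lra.
Qed.

(** The density is the Radon-Nikodym derivative of the Stieltjes measure, which
is finite because F is bounded. *)
Lemma nondecreasing_abs_cont_density : exists f : R -> R,
  mu.-integrable setT (EFin \o f) /\
  forall x y, x <= y -> F y - F x = \int[mu]_(z in `[x, y]) f z.
Proof.
pose nu' : {finite_measure set _ -> \bar R} := mfrestr measurableT nu_setT.
have nu'E A : nu' A = nu A.
  change (nu (A `&` setT) = nu A).
  by rewrite setIT.
have nu'_dom : nu' `<< mu.
  move=> A /nu_dominated A0 B mB BA.
  by rewrite nu'E; exact: A0.
have [f [f0 ffin intf nuf]] :=
  @radon_nikodym_sigma_finite _ _ R lebesgue_measure nu' nu'_dom.
have fE : EFin \o (fine \o f) = f.
  by apply/funext => x /=; rewrite fineK.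
exists (fine \o f); rewrite fE; split => // x y xy.
rewrite /Rintegral -[F y - F x]/(fine (F y - F x)%:E) -nu_cc//; congr fine.
by rewrite -nu'E nuf//; apply: eq_integral => z _; rewrite -[in LHS]fE.
Qed.

End density.
End stieltjes_density.

(** * Variation of absolutely continuous functions *)

Section interval_families.
Context {R : realType}.
Implicit Types (a b : R) (u : R -> R).

(** Arbitrary finite index types make it possible to index by pairs below. *)
Lemma abs_cont_fin a b u : abs_cont a b u -> forall e : R, 0 < e ->
  exists2 d : R, 0 < d & forall (I : finType) (s t : I -> R),
    (forall i, a <= s i <= t i /\ t i <= b) ->
    trivIset setT (fun i => `]s i, t i[%classic) ->
    \sum_i (t i - s i) < d -> \sum_i `|u (t i) - u (s i)| < e.
Proof.
move=> ac e e0; have [d d0 dP] := ac _ e0; exists d => // I s t st tst.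
rewrite (reindex (@enum_val I xpredT)) /=; last exact/onW_bij/enum_val_bij.
rewrite [X in _ -> X < _](reindex (@enum_val I xpredT)) /=; last first.
  exact/onW_bij/enum_val_bij.
apply: dP => // i j _ _ ij; apply: enum_val_inj.
exact: tst.
Qed.

Lemma itv_partition_nth_homo a b p : itv_partition a b p ->
  nondecreasing_seq (nth b (a :: p)).
Proof.
move=> abp; apply/nondecreasing_seqP => k.
have [kp|kp] := ltnP k (size p).
  exact: (@nondecreasing_fun_itv_partition _ _ a b id p _ abp k kp).
rewrite [leRHS]nth_default//.
move: kp; rewrite leq_eqVlt => /predU1P[<-|kp]; last by rewrite nth_default.
by rewrite itv_partition_nth_le.
Qed.

Lemma itv_partition_nth_ge_size a b p k : itv_partition a b p ->
  (size p <= k)%N -> nth b (a :: p) k = b.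
Proof.
move=> abp; rewrite leq_eqVlt => /predU1P[<-|kp]; last by rewrite nth_default.
exact: itv_partition_nth_size abp.
Qed.

(** Reading the partition with the default value b pads it with degenerate
intervals, so that partitions of different sizes can share one index range. *)
Lemma variation_widen a b u p M : itv_partition a b p -> (size p <= M)%N ->
  variation a b u p =
  \sum_(k < M) `|u (nth b (a :: p) k.+1) - u (nth b (a :: p) k)|.
Proof.
move=> abp pM; rewrite -(big_mkord xpredT
  (fun k => `|u (nth b (a :: p) k.+1) - u (nth b (a :: p) k)|)).
rewrite (big_cat_nat (leq0n _) pM) [X in _ = _ + X]big_nat_cond [X in _ = _ + X]big1 ?addr0//.
move=> k /andP[/andP[pk kM] _].
by rewrite !(itv_partition_nth_ge_size abp) ?leqW// subrr normr0.
Qed.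

(** Partitioning each interval of a small disjoint family leaves the total length
unchanged, so that absolute continuity also controls the sum of the variations. *)
Lemma abs_cont_variation a b u : abs_cont a b u -> forall e : R, 0 < e ->
  exists2 d : R, 0 < d & forall (n : nat) (s t : 'I_n -> R) (p : 'I_n -> seq R),
    (forall i, a <= s i <= t i /\ t i <= b) ->
    (forall i, itv_partition (s i) (t i) (p i)) ->
    trivIset setT (fun i => `]s i, t i[%classic) ->
    \sum_i (t i - s i) < d -> \sum_i variation (s i) (t i) u (p i) < e.
Proof.
move=> ac e e0; have [d d0 dP] := abs_cont_fin ac e0; exists d => //.
move=> n s t p st stp tst sumd.
pose M := (\max_(i < n) size (p i))%N.
have pM i : (size (p i) <= M)%N by exact: leq_bigmax.
pose c i k := nth (t i) (s i :: p i) k.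
have ndc i : nondecreasing_seq (c i) by exact: itv_partition_nth_homo.
have c0 i : c i 0%N = s i by [].
have cM i k : (size (p i) <= k)%N -> c i k = t i.
  exact: itv_partition_nth_ge_size.
have sc i k : s i <= c i k by rewrite -c0; exact: ndc.
have ct i k : c i k <= t i by rewrite -(cM i (maxn k (size (p i)))) ?leq_maxr//; apply: ndc; exact: leq_maxl.
have := dP ('I_n * 'I_M)%type (fun ik => c ik.1 ik.2) (fun ik => c ik.1 ik.2.+1).
have sumE (f : 'I_n -> nat -> R) :
    \sum_(ik : 'I_n * 'I_M) f ik.1 ik.2 = \sum_(i < n) \sum_(k < M) f i k.
  by rewrite pair_bigA.
rewrite (sumE (fun i k => c i k.+1 - c i k)).
rewrite (sumE (fun i k => `|u (c i k.+1) - u (c i k)|)).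
rewrite [X in _ -> X < e](_ : _ = \sum_(i < n) \sum_(k < M) `|u (c i k.+1) - u (c i k)|); last first.
  by apply: eq_bigr => i _; exact: variation_widen.
apply.
- move=> [i k]/=; have [/andP[si _] ti] := st i; rewrite (le_trans si)//=.
  by rewrite ndc//= (le_trans _ ti).
- move=> [i k] [j l] _ _ /= [x []] /=; rewrite !in_itv/= => /andP[x1 x2] /andP[y1 y2].
  have ij : i = j.
    apply: tst => //; exists x; split => /=; rewrite in_itv/=.
      by rewrite (le_lt_trans (sc _ _) x1) (lt_le_trans x2).
    by rewrite (le_lt_trans (sc _ _) y1) (lt_le_trans y2).
  rewrite -ij in y1 y2 *; congr pair; apply/val_inj/eqP.
  rewrite eqn_leq; apply/andP; split; rewrite leqNgt; apply/negP => kl.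
    by have := ndc i _ _ kl; rewrite leNgt (lt_trans x1 y2).
  by have := ndc i _ _ kl; rewrite leNgt (lt_trans y1 x2).
- rewrite (le_lt_trans _ sumd)//; apply: ler_sum => i _.
  rewrite -(big_mkord xpredT (fun k => c i k.+1 - c i k)) telescope_sumr//.
  by rewrite c0 cM.
Qed.

End interval_families.

(** * The fundamental theorem of calculus for absolutely continuous functions *)

Section fundamental_theorem.
Context {R : realType}.
Implicit Types (a b : R) (u : R -> R).
Local Notation TV := total_variation.
Local Notation mu := (@lebesgue_measure R).

Lemma total_variation_leP a b u (M : R) :
  (forall p, itv_partition a b p -> variation a b u p <= M) ->
  (TV a b u <= M%:E)%E.
Proof.
by move=> H; apply: ge_ereal_sup => _ [_ [p abp <-] <-]; rewrite lee_fin H.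
Qed.

(** The variation over an interval shorter than the d of e = 1 is at most 1, and
finitely many such intervals cover [a, b]. *)
Lemma abs_cont_bounded_variation a b u :
  a <= b -> abs_cont a b u -> bounded_variation a b u.
Proof.
move=> ab ac; have [d d0 dP] := abs_cont_variation ac ltr01.
have small x y : a <= x -> x <= y -> y <= b -> y - x < d -> (TV x y u < +oo)%E.
  move=> ax xy yb yxd; rewrite (@le_lt_trans _ _ 1%:E) ?ltry//.
  apply: total_variation_leP => p xyp; apply/ltW.
  have := dP 1%N (fun=> x) (fun=> y) (fun=> p).
  rewrite !big_ord_recl !big_ord0 !addr0; apply => //.
  - by rewrite ax xy.
  - by move=> i j _ _ _; rewrite (ord1 i) (ord1 j).
(* induction on the number of steps of length d / 2 *)
suff H (k : nat) y : a <= y <= b -> y - a <= k%:R * (d / 2) -> (TV a y u < +oo)%E.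
  apply/(bounded_variationP _ ab).
  rewrite ge0_fin_numE ?total_variation_ge0//.
  apply: (H (Num.truncn ((b - a) / (d / 2))).+1); first by rewrite ab lexx.
  rewrite -ler_pdivrMr ?divr_gt0//; apply/ltW/truncnS_gt.
elim: k y => [|k IH] y /andP[ay yb].
  rewrite mul0r subr_le0 => ya.
  by have -> : y = a by [apply/eqP; rewrite eq_le ya ay]; rewrite total_variationxx ltry.
move=> yk; pose x := Num.max a (y - d / 2).
have ax : a <= x by rewrite le_max lexx.
have xy : x <= y by rewrite ge_max ay /= lerBlDr lerDl divr_ge0// ltW.
rewrite (total_variationD _ ax xy) lte_add_pinfty//.
  apply: IH; first by rewrite ax (le_trans xy).
  rewrite lerBlDr ge_max; apply/andP; split.
    by rewrite lerDr mulr_ge0// divr_ge0// ltW.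
  by move: yk; rewrite mulrSr mulrDl mul1r; lra.
apply: small => //; rewrite ltrBlDr -ltrBlDl lt_max; apply/orP; right.
by rewrite ltrD2l ltrN2 ltr_pdivrMr// ltr_pMr// ltr1n.
Qed.

(** The variation over each interval is nearly attained by a partition, and the
sum of these partial variations is small. *)
Lemma abs_cont_total_variation a b u : a <= b -> abs_cont a b u ->
  abs_cont a b (fun x => fine (TV a x u)).
Proof.
move=> ab ac e e0.
have e20 : 0 < e / 2 by rewrite divr_gt0.
have [d d0 dP] := abs_cont_variation ac e20; exists d => // n s t st tst sumd.
have BVu := abs_cont_bounded_variation ab ac.
have fTV x y : a <= x -> x <= y -> y <= b -> TV x y u \is a fin_num.
  move=> ax xy yb; apply/bounded_variationP => //.
  apply: (bounded_variationl xy yb); apply: (bounded_variationr ax _ BVu).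
  exact: le_trans yb.
have TVB i : `|fine (TV a (t i) u) - fine (TV a (s i) u)| = fine (TV (s i) (t i) u).
  have [/andP[asi sti] tb] := st i.
  rewrite (total_variationD u asi sti) fineD ?fTV ?(le_trans sti)//.
  by rewrite addrC addKr ger0_norm// fine_ge0// total_variation_ge0.
(* the sup is approximated within h on each of the n intervals; n + 1 avoids a
   division by zero *)
pose h := e / 2 / n.+1%:R.
have h0 : 0 < h by rewrite divr_gt0.
have /choice[p pP] i : exists p, itv_partition (s i) (t i) p /\
    fine (TV (s i) (t i) u) - h < variation (s i) (t i) u p.
  have [/andP[asi sti] tb] := st i.
  have : ((fine (TV (s i) (t i) u) - h)%:E < TV (s i) (t i) u)%E.
    by rewrite -[ltRHS]fineK ?fTV// lte_fin ltrBlDr ltrDl.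
  by move=> /ereal_sup_gt[_ [_ [p stp <-] <-]]; rewrite lte_fin; exists p.
under eq_bigr do rewrite TVB.
rewrite (@le_lt_trans _ _ (\sum_(i < n) (variation (s i) (t i) u (p i) + h)))//.
  by apply: ler_sum => i _; have [_ /ltW] := pP i; rewrite lerBlDr.
rewrite big_split/= sumr_const card_ord [e]splitr; apply: ltr_leD.
  by apply: dP => // i; case: (pP i).
rewrite -[h *+ n]mulr_natr /h -(mulrA (e / 2)) ler_piMr ?(ltW e20)//.
by rewrite mulrC ler_pdivrMr// mul1r ler_nat.
Qed.

Lemma abs_contB a b u v : abs_cont a b u -> abs_cont a b v ->
  abs_cont a b (fun x => u x - v x).
Proof.
move=> acu acv e e0; have e20 : 0 < e / 2 by rewrite divr_gt0.
have [d d0 dP] := acu _ e20; have [d' d'0 dP'] := acv _ e20.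
exists (Num.min d d'); first by rewrite lt_min d0.
move=> n s t st tst; rewrite lt_min => /andP[sd sd'].
rewrite (le_lt_trans _ (_ : \sum_(i < n) (`|u (t i) - u (s i)| + `|v (t i) - v (s i)|) < e))//.
  apply: ler_sum => i _; apply: le_trans (ler_normB _ _).
  have -> : u (t i) - v (t i) - (u (s i) - v (s i)) =
    u (t i) - u (s i) - (v (t i) - v (s i)) by ring.
  by [].
by rewrite big_split/= [e]splitr ltrD// ?dP ?dP'.
Qed.

(** Composition with this retraction extends functions on [a, b] to the line. *)
Definition clamp a b x : R := Num.max a (Num.min x b).

Lemma abs_cont_clamp a b u : a <= b -> abs_cont a b u -> abs_contT (u \o clamp a b).
Proof.
move=> ab ac e e0; have [d d0 dP] := ac _ e0; exists d => // n s t st tst sd.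
have cb x : a <= clamp a b x <= b.
  by rewrite /clamp le_max lexx ge_max ab ge_min lexx orbT.
have cle x y : x <= y -> 0 <= clamp a b y - clamp a b x <= y - x.
  clear -ab => xy; rewrite /clamp.
  by case: (leP x b) => xb; case: (leP y b) => yb;
    case: (leP a x) => ?; case: (leP a y) => ?; case: (leP a b) => ?; lra.
apply: dP.
- move=> i; have /andP[-> _] := cb (s i); have /andP[_ ->] := cb (t i).
  by have /andP[] := cle _ _ (st i); rewrite subr_ge0.
- have sub x i : `]clamp a b (s i), clamp a b (t i)[%classic x -> `]s i, t i[%classic x.
    clear -ab; rewrite /= !in_itv/= /clamp; move: (s i) (t i) => y z.
    by case: (leP y b) => yb; case: (leP z b) => zb;
    case: (leP a z) => ?; case: (leP a y) => ?; case: (leP a b) => ?; lra.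
  by move=> i j _ _ [x [xi xj]]; apply: tst => //; exists x; split; exact: sub.
- rewrite (le_lt_trans _ sd)//; apply: ler_sum => i _.
  by have /andP[] := cle _ _ (st i).
Qed.

(** Jordan decomposition u = V - (V - u), with V the total variation function:
both parts are nondecreasing and absolutely continuous. *)
Lemma abs_cont_density a b u : a <= b -> abs_cont a b u ->
  exists2 k : R -> R, mu.-integrable setT (EFin \o k) &
    forall x, a <= x <= b -> u x = u a + \int[mu]_(z in `[a, x]) k z.
Proof.
move=> ab ac; pose V x := fine (TV a x u).
have acV := abs_cont_total_variation ab ac.
have BVu := abs_cont_bounded_variation ab ac.
have clampP x : a <= clamp a b x <= b.
  by rewrite /clamp le_max lexx ge_max ab ge_min lexx orbT.
have clampE x : a <= x <= b -> clamp a b x = x.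
  by move=> /andP[ax xb]; rewrite /clamp (min_idPl xb) (max_idPr ax).
have clamp_nd x y : x <= y -> clamp a b x <= clamp a b y.
  by clear => xy; rewrite /clamp; case: (leP x b) => xb; case: (leP y b) => yb;
    case: (leP a x) => ?; case: (leP a y) => ?; case: (leP a b) => ?; lra.
have fTV x y : a <= x -> x <= y -> y <= b -> TV x y u \is a fin_num.
  move=> ax xy yb; apply/bounded_variationP => //.
  apply: (bounded_variationl xy yb); apply: (bounded_variationr ax _ BVu).
  exact: le_trans yb.
have ndVu x y : a <= x -> x <= y -> y <= b -> `|u y - u x| <= V y - V x.
  move=> ax xy yb; rewrite /V (total_variationD u ax xy) fineD ?fTV ?(le_trans xy)//.
  rewrite [leRHS]addrAC subrr add0r -lee_fin fineK ?fTV//; exact: total_variation_ge.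
have density F : abs_cont a b F -> (forall x y, a <= x -> x <= y -> y <= b -> F x <= F y) ->
    exists2 k : R -> R, mu.-integrable setT (EFin \o k) &
    forall x, a <= x <= b -> F x - F a = \int[mu]_(z in `[a, x]) k z.
  move=> acF ndF; have [||k [ik kE]] := @nondecreasing_abs_cont_density R (F \o clamp a b) _ (abs_cont_clamp ab acF).
  - move=> x y xy /=; apply: ndF; [|exact: clamp_nd|].
      by case/andP: (clampP x).
    by case/andP: (clampP y).
  - exists (F a, F b) => x /=; have /andP[ac' cb] := clampP x.
    by rewrite !ndF//.
  exists k => // x /andP[ax xb]; rewrite -kE//= !clampE ?ax ?lexx ?ab//.
have [|k1 ik1 k1E] := density V acV.
  by move=> x y ax xy yb; rewrite -subr_ge0; apply: le_trans (ndVu _ _ ax xy yb).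
have [|k2 ik2 k2E] := density (fun x => V x - u x) (abs_contB acV ac).
  move=> x y ax xy yb; have := ndVu _ _ ax xy yb; rewrite ler_norml; lra.
have ik x k : mu.-integrable setT (EFin \o k) -> mu.-integrable `[a, x] (EFin \o k).
  by move=> i; apply: integrableS i.
exists (fun x => k1 x - k2 x).
  by apply: (integrableB measurableT ik1 ik2).
move=> x axb; rewrite RintegralB ?ik// -k1E// -k2E//; lra.
Qed.

End fundamental_theorem.

Section abs_cont_derivative.
Context {R : realType}.
Local Notation mu := (@lebesgue_measure R).

Lemma ae_neq (c : R) : {ae mu, forall y, y != c}.
Proof.
exists [set c]; split => //; first exact: lebesgue_measure_set1.
by move=> y /= /negP; rewrite negbK => /eqP.
Qed.

(** By the fundamental theorem, u is the primitive of a density k, which agrees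
almost everywhere with the derivative of u, hence with h; so u is the primitive
of the continuous function h. *)
Lemma abs_cont_is_derive (a b : R) (u h : R -> R) : abs_cont a b u ->
  (forall x, a <= x <= b -> {for x, continuous h}) ->
  ae_eq_on `]a, b[ (derive1 u) h ->
  forall x, a < x < b -> is_derive x 1 u (h x).
Proof.
move=> ac ch uh x /andP[ax xb]; have ab : a <= b by rewrite ltW// (lt_trans ax).
have [k ik uE] := abs_cont_density ab ac.
have aeF := ae_filter_ringOfSetsType mu.
have near_ab y : a < y < b -> \forall z \near y, a < z < b.
  by move=> yab; apply: (@near_in_itvoo _ a b y); rewrite in_itv/= yab.
have ikS A : measurable A -> mu.-integrable A (EFin \o k).
  by move=> mA; apply: integrableS ik.
have lk : locally_integrable [set: R] k.
  by apply: open_integrable_locally => //; exact: openT.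
have transfer (f : R -> R) (c y : R) : (forall z, a <= z <= b -> u z = u a + f z) ->
    a < y < b -> derivable f y 1 /\ derive1 f y = c -> is_derive y 1 u c.
  move=> uf yab [df fE].
  apply: (@near_eq_is_derive _ _ _ (fun z => u a + f z)).
    near=> z; rewrite [RHS]uf//.
    by have /andP[/ltW -> /ltW ->] : a < z < b by near: z; exact: near_ab.
  have fd : is_derive y 1 f c by split => //; rewrite -derive1E.
  by rewrite -[c]add0r; exact: (@is_deriveD _ _ _ (cst (u a)) f).
have kh : ae_eq_on `]a, b[ k h.
  have FT := FTC1 (a := BLeft a) (fun y => ikS _ (measurable_itv _)) lk.
  apply: (filterS2 _ _ uh FT) => y uhy Fy yab; rewrite -uhy//.
  move: yab; rewrite /= in_itv/= => yab.
  have ay : (BLeft a < BRight y)%E by rewrite lte_fin; case/andP: yab.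
  have dk := transfer _ _ _ uE yab (Fy ay).
  by rewrite derive1E derive_val.
have ih : mu.-integrable `[a, b] (EFin \o h).
  apply: continuous_compact_integrable; first exact: segment_compact.
  apply: continuous_in_subspaceT => y; rewrite inE/= in_itv/=; exact: ch.
apply: (transfer (fun y => \int[mu]_(z in `[a, y]) h z)); last 2 first.
- by rewrite ax.
- by apply: (continuous_FTC1_closed xb ih ax); apply: ch; rewrite !ltW.
move=> z /andP[az zb]; rewrite uE ?az//; congr (_ + _).
rewrite /Rintegral; congr fine; apply: ae_eq_integral => //.
- by have /integrableP[] := ikS `[a, z]%classic (measurable_itv _).
- apply: measurable_funS (measurable_int _ ih) => //.
  by apply: subset_itvl; rewrite bnd_simp.
- apply: (filterS3 _ _ kh (ae_neq a) (ae_neq b)) => y khy ya yb.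
  rewrite /= in_itv/= => /andP[ay yz]; congr EFin; apply: khy.
  rewrite /= in_itv/= !lt_neqAle ay yb eq_sym ya/=.
  exact: le_trans zb.
Unshelve. all: end_near. Qed.
End abs_cont_derivative.

(** * The space H *)

Section L2.
Context {R : realType}.
Local Notation mu := (@lebesgue_measure R).
Local Notation I := (@intI R).
Implicit Types (u v f g : R -> R).

(** The norm of H as a real number, equal to 0 where the norm is infinite. *)
Definition hnorm f : R := fine (normH f).

Lemma measurable_I : measurable (I : set (measurableTypeR R)).
Proof. exact: measurable_itv. Qed.
Hint Resolve measurable_I : core.

Lemma mu_I : mu I = 2%:E.
Proof.
rewrite /intI lebesgue_measure_itv/= lte_fin.
have -> : (-1 < 1 :> R) = true by lra.
by rewrite -EFinB; congr EFin; lra.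
Qed.

Lemma memHP f : memH f <->
  measurable_fun I f /\ (normH f < +oo)%E.
Proof.
rewrite /memH /mem_Lp /normH /Lp_norm; split.
  move=> /andP[]; rewrite !inE/= => mf nf; split => //.
  exact/(measurable_restrictT _ _).2.
move=> [mf nf]; apply/andP; rewrite !inE/=; split => //.
exact/(measurable_restrictT _ _).1.
Qed.

Lemma memH_measurable f : memH f -> measurable_fun I f.
Proof. by move=> /memHP[]. Qed.

Lemma hnormE f : memH f -> normH f = (hnorm f)%:E.
Proof.
move=> /memHP[_ nf]; rewrite /hnorm fineK// ge0_fin_numE//; exact: Lnorm_ge0.
Qed.

Lemma hnorm_ge0 f : 0 <= hnorm f.
Proof. by rewrite /hnorm fine_ge0//; exact: Lnorm_ge0. Qed.

Lemma patchB f g : (fun x => f x - g x) \_ I = (f \_ I) - (g \_ I).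
Proof.
by apply/funext => x; rewrite !fctE /patch; case: ifP => // _; rewrite subr0.
Qed.

Lemma patchZ (c : R) f : (fun x => c * f x) \_ I = c *: (f \_ I).
Proof.
by apply/funext => x; rewrite !fctE /patch; case: ifP => // _; rewrite /GRing.scale/= mulr0.
Qed.

Lemma eq_patch f g : {in I, f =1 g} -> f \_ I = g \_ I.
Proof. by move=> fg; apply/funext => x; rewrite /patch; case: ifPn => // /fg. Qed.

Lemma eq_hnorm f g : {in I, f =1 g} -> hnorm f = hnorm g.
Proof. by move=> fg; rewrite /hnorm /normH /Lp_norm (eq_patch fg). Qed.

Lemma eq_memH f g : {in I, f =1 g} -> memH f -> memH g.
Proof. by move=> fg; rewrite /memH /mem_Lp (eq_patch fg). Qed.

Let p2 : (1 <= 2%:E :> \bar R)%E. Proof. by rewrite lee_fin ler1n. Qed.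

Lemma memHB f g : memH f -> memH g -> memH (fun x => f x - g x).
Proof.
rewrite /memH /mem_Lp patchB => mf mg.
have [_ H] := @Lfun_submod_closed _ _ _ mu _ p2.
by rewrite addrC -scaleN1r; exact: H.
Qed.

Lemma memHZ (c : R) f : memH f -> memH (fun x => c * f x).
Proof.
rewrite /memH /mem_Lp patchZ => mf.
have [H0 H] := @Lfun_submod_closed _ _ _ mu _ p2.
by rewrite -[_ *: _]addr0; exact: H.
Qed.

Lemma memHD f g : memH f -> memH g -> memH (fun x => f x + g x).
Proof.
move=> mf mg; apply: (@eq_memH (fun x => f x - (-1 * g x))).
  by move=> x _; rewrite mulN1r opprK.
by apply: memHB => //; exact: memHZ.
Qed.

Lemma hnormZ (c : R) f : memH f -> hnorm (fun x => c * f x) = `|c| * hnorm f.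
Proof.
move=> mf; apply: EFin_inj; rewrite EFinM -!hnormE//; last exact: memHZ.
rewrite /normH /Lp_norm patchZ.
have := @LnormZ _ _ _ mu _ p2 (@Lfun_Sub _ _ _ mu _ p2 _ mf) c.
by rewrite /= => ->.
Qed.

Lemma le_hnormD f g : memH f -> memH g ->
  hnorm (fun x => f x + g x) <= hnorm f + hnorm g.
Proof.
move=> mf mg; rewrite -lee_fin EFinD -!hnormE//; last exact: memHD.
have -> : normH (fun x => f x + g x) = Lnorm mu 2%:E (EFin \o ((f \_ I) \+ (g \_ I))%R).
  rewrite /normH /Lp_norm; congr (Lnorm _ _ (_ \o _)).
  by apply/funext => x; rewrite /patch/=; case: ifP => // _; rewrite addr0.
by apply: eminkowski => //; apply/(measurable_restrictT _ _).1 => //; exact: memH_measurable.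
Qed.

Lemma hnormN f : memH f -> hnorm (fun x => - f x) = hnorm f.
Proof.
move=> mf; rewrite -[RHS]mul1r -(normrN1 R) -hnormZ//.
by apply: eq_hnorm => x _; rewrite mulN1r.
Qed.

Lemma le_hnormB f g : memH f -> memH g ->
  hnorm (fun x => f x - g x) <= hnorm f + hnorm g.
Proof.
move=> mf mg; rewrite -(hnormN mg); apply: le_hnormD => //.
by apply: eq_memH (memHZ (-1) mg) => x _; rewrite mulN1r.
Qed.

Let sqr_patch f : (EFin \o (fun x => f x ^+ 2)) \_ I = EFin \o (fun x => (f \_ I) x ^+ 2).
Proof.
by apply/funext => x; rewrite /patch/=; case: ifP => // _; rewrite expr0n.
Qed.

Lemma hnorm_sqr_integrable f : memH f -> mu.-integrable I (EFin \o (fun x => f x ^+ 2)).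
Proof.
move=> /Lfun2_integrable_sqr mf; apply/integrable_mkcond => //.
by rewrite sqr_patch.
Qed.

Lemma hnorm_sqr f : memH f -> hnorm f ^+ 2 = \int[mu]_(x in I) (f x ^+ 2).
Proof.
move=> mf; have := @poweR_Lnorm _ _ _ mu (EFin \o (f \_ I)) 2 _.
rewrite -[Lnorm _ _ _]/(normH f) hnormE// poweR_EFin powR_mulrn ?hnorm_ge0// => H.
rewrite /Rintegral integral_mkcond.
rewrite -[LHS]/(fine (hnorm f ^+ 2)%:E) H//; congr fine.
apply: eq_integral => x _; rewrite /patch/=; case: ifP => _.
  by rewrite powR_mulrn// real_normK ?num_real.
by rewrite normr0 powR_mulrn// expr0n.
Qed.

Lemma hnorm_eq0 f : memH f -> hnorm f = 0 -> ae_eq_on I f (fun=> 0).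
Proof.
move=> mf f0.
have N0 : normH f = 0%E by rewrite hnormE// f0.
have p0 : (0 < 2%:E :> \bar R)%E by rewrite lte_fin.
have := @Lnorm_eq0_eq0 _ _ _ mu (EFin \o (f \_ I)) _ _ p0 N0.
set P := measurable_fun _ _; have mP : P; last move=> /(_ mP).
  by apply/measurable_EFinP/(measurable_restrictT _ _).1 => //; exact: memH_measurable.
have aeF := ae_filter_ringOfSetsType mu.
move=> H; apply: filterS H => x /(_ Logic.I) /= [+] Ix.
by rewrite patchE mem_set.
Qed.

(** The inequality of Cauchy and Schwarz for the extensions by zero. *)
Lemma memH_mul f g : memH f -> memH g ->
  mu.-integrable I (EFin \o (fun x => f x * g x)) /\
  \int[mu]_(x in I) `|f x * g x| <= hnorm f * hnorm g.
Proof.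
move=> mf mg.
have fg : EFin \o ((f \_ I) \* (g \_ I))%R = (EFin \o (fun x => f x * g x)) \_ I.
  by apply/funext => x; rewrite /patch/=; case: ifP => // _; rewrite mulr0.
have ifg : mu.-integrable I (EFin \o (fun x => f x * g x)).
  apply/integrable_mkcond => //; rewrite -fg.
  by apply/Lfun1_integrable; exact: Lfun2_mul_Lfun1.
split => //.
have mfT : measurable_fun setT (f \_ I).
  by apply/(measurable_restrictT _ _).1 => //; exact: memH_measurable.
have mgT : measurable_fun setT (g \_ I).
  by apply/(measurable_restrictT _ _).1 => //; exact: memH_measurable.
have H : ('N[mu]_1[EFin \o ((f \_ I) \* (g \_ I))%R] <= normH f * normH g)%E.
  by apply: hoelder => //; rewrite [RHS]splitr !div1r.
rewrite -lee_fin EFinM -!hnormE//; apply: le_trans H; rewrite Lnorm1.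
rewrite fg /Rintegral fineK; last first.
  by apply: integrable_fin_num => //; exact: (integrable_abse ifg).
rewrite integral_mkcond; rewrite le_eqVlt; apply/orP; left; apply/eqP.
by apply: eq_integral => x _; rewrite /patch/=; case: ifP => // _; rewrite abse0.
Qed.

Lemma bounded_integrable f (M : R) : measurable_fun I f ->
  (forall x, I x -> `|f x| <= M) -> mu.-integrable I (EFin \o f).
Proof.
move=> mf fM; apply: measurable_bounded_integrable => //.
  by rewrite [ltLHS]mu_I ltry.
exists M; split; first exact: num_real.
by move=> N MN x Ix; apply: le_trans (fM x Ix) (ltW MN).
Qed.

Lemma memH_sqr_integrable f : measurable_fun I f ->
  mu.-integrable I (EFin \o (fun x => f x ^+ 2)) -> memH f.
Proof.
move=> mf if2; apply/memHP; split => //.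
rewrite /normH /Lp_norm unlock; apply: poweR_lty.
have := (integrable_mkcond _ measurable_I).1 if2; rewrite sqr_patch.
move=> /integrableP[_]; apply: le_lt_trans.
rewrite le_eqVlt; apply/orP; left; apply/eqP/eq_integral => x _ /=.
by rewrite normrX powR_mulrn.
Qed.

Lemma memH_bounded f (M : R) : measurable_fun I f ->
  (forall x, I x -> `|f x| <= M) -> memH f.
Proof.
move=> mf fM; apply: memH_sqr_integrable => //.
apply: (@bounded_integrable _ (M ^+ 2)).
  exact: measurable_funX.
move=> x Ix; rewrite normrX lerXn2r ?nnegrE ?normr_ge0//; last exact: fM.
exact: le_trans (fM x Ix).
Qed.

Lemma hnorm_bounded f (M : R) : 0 <= M -> measurable_fun I f ->
  (forall x, I x -> `|f x| <= M) -> hnorm f <= 2 * M.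
Proof.
move=> M0 mf fM; have mfH := memH_bounded mf fM.
rewrite -(@ler_pXn2r _ 2)// ?nnegrE ?hnorm_ge0 ?mulr_ge0//.
rewrite hnorm_sqr//.
apply: (@le_trans _ _ (\int[mu]_(x in I) (M ^+ 2))).
  apply: le_Rintegral => //.
  - exact: hnorm_sqr_integrable.
  - by apply: (@bounded_integrable _ (M ^+ 2)) => // x _; rewrite ger0_norm// sqr_ge0.
  - move=> x Ix; rewrite -real_normK ?num_real// lerXn2r ?nnegrE ?normr_ge0//.
    exact: fM.
rewrite Rintegral_cst// [X in fine X]mu_I/= exprMn mulrC.
by rewrite ler_wpM2r ?sqr_ge0//; lra.
Qed.

Lemma memH_integrable f : memH f -> mu.-integrable I (EFin \o f).
Proof.
move=> mf; have m1 : memH (fun=> 1 : R).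
  by apply: (@memH_bounded _ 1) => // x _; rewrite normr1.
have [+ _] := memH_mul mf m1.
by under eq_fun do rewrite mulr1.
Qed.

Lemma le_hnorm_int f g : memH f -> memH g ->
  `|\int[mu]_(x in I) (f x * g x)| <= hnorm f * hnorm g.
Proof.
move=> mf mg; have [i le] := memH_mul mf mg.
by apply: le_trans le; exact: le_normr_Rintegral.
Qed.

Lemma le_hnorm_diff f g : memH f -> memH g ->
  `|hnorm f - hnorm g| <= hnorm (fun x => f x - g x).
Proof.
wlog fg : f g / hnorm g <= hnorm f.
  move=> H mf mg; have [gf|/ltW fg] := leP (hnorm g) (hnorm f); first exact: H.
  rewrite distrC (le_trans (H _ _ fg mg mf))// le_eqVlt; apply/orP; left; apply/eqP.
  rewrite -hnormN; last exact: memHB.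
  by apply: eq_hnorm => x _; rewrite opprB.
move=> mf mg; rewrite ger0_norm ?subr_ge0// lerBlDr.
rewrite (_ : hnorm f = hnorm (fun x => (f x - g x) + g x)).
  by apply: le_hnormD => //; exact: memHB.
by apply: eq_hnorm => x _; rewrite subrK.
Qed.

End L2.

(** * Primitives of elements of H *)

Section primitive.
Context {R : realType}.
Local Notation mu := (@lebesgue_measure R).
Local Notation I := (@intI R).
Implicit Types (f g phi : R -> R).
Hint Resolve measurable_I : core.

Lemma C1_Rintegral (a b : R) phi : a < b ->
  (forall x, a <= x <= b -> derivable phi x 1) ->
  (forall x, a <= x <= b -> {for x, continuous (derive1 phi)}) ->
  \int[mu]_(x in `[a, b]) derive1 phi x = phi b - phi a.
Proof.
move=> ab dphi cphi; rewrite /Rintegral (@continuous_FTC2 _ _ phi)//.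
- by apply: continuous_in_subspaceT => x; rewrite inE/= in_itv/=; exact: cphi.
- have cc x : a <= x <= b -> {for x, continuous phi}.
    by move=> xab; apply/differentiable_continuous/derivable1_diffP/dphi.
  split.
  + by move=> x; rewrite in_itv/= => /andP[ax xb]; apply: dphi; rewrite !ltW.
  + by apply: cvg_at_right_filter; apply: cc; rewrite lexx ltW.
  + by apply: cvg_at_left_filter; apply: cc; rewrite lexx ltW.
Qed.

Lemma test_fun_out phi x : test_fun I phi -> ~ I x -> phi x = 0.
Proof. by move=> [_ _ [K [_ KI K0]]] nIx; apply: K0 => /KI. Qed.

Lemma continuous_memH f : continuous f -> memH f.
Proof.
move=> cf.
have : bounded_set (f @` `[-1, 1]).
  apply/compact_bounded/continuous_compact; last exact: segment_compact.
  exact: continuous_subspaceT.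
move=> [M [_ /(_ (M + 1))]]; rewrite ltrDl ltr01 => /(_ isT) fM.
apply: (@memH_bounded _ _ (M + 1)).
  by apply: measurable_funTS; exact: continuous_measurable_fun.
move=> x; rewrite /intI/= in_itv/= => /andP[x1 x2]; apply: fM; exists x => //.
by rewrite /= in_itv/= !ltW.
Qed.

Lemma test_fun_memH phi : test_fun I phi -> memH phi /\ memH (derive1 phi).
Proof.
move=> [dphi cphi' _]; split; apply: continuous_memH => // x.
exact/differentiable_continuous/derivable1_diffP/dphi.
Qed.

Lemma hnorm_indic (A : set R) : measurable (A : set (measurableTypeR R)) -> A `<=` I ->
  memH (\1_A : R -> R) /\ hnorm (\1_A : R -> R) ^+ 2 = fine (mu A).
Proof.
move=> mA AI; have m1 : memH (\1_A : R -> R).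
  apply: (@memH_bounded _ _ 1); first exact: measurable_indic.
  by move=> x _; rewrite indicE; case: (x \in A); rewrite ?normr1 ?normr0.
split => //; rewrite hnorm_sqr// /Rintegral; congr fine.
have {2}-> : A = A `&` I by apply/esym/setIidPl.
rewrite -integral_indic//.
by apply: eq_integral => x _; rewrite indicE; case: (x \in A); rewrite ?expr1n ?expr0n.
Qed.

(** The primitive of g vanishing at -1, written as an integral over I against an
indicator, so that the inequality of Cauchy and Schwarz in H applies. *)
Definition prim g (x : R) : R := \int[mu]_(z in I) (g z * \1_`]-1, x] z).

Let subl x : I x -> `]-1, x] `<=` I.
Proof.
rewrite /intI/= in_itv/= => /andP[_ x1] z/=.
by rewrite !in_itv/= => /andP[-> /le_lt_trans ->].
Qed.

Let subr x : I x -> `]x, 1[ `<=` I.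
Proof.
rewrite /intI/= in_itv/= => /andP[x1 _] z/=.
by rewrite !in_itv/= => /andP[/(lt_trans x1) -> ->].
Qed.

Let norml x : I x -> memH (\1_(`]-1, x]) : R -> R) /\ hnorm (\1_(`]-1, x]) : R -> R) = Num.sqrt (1 + x).
Proof.
move=> Ix; have [//||m n] := @hnorm_indic `]-1, x]%classic; first exact: subl.
split => //; rewrite -[LHS]ger0_norm ?hnorm_ge0// -sqrtr_sqr n.
congr Num.sqrt; rewrite lebesgue_measure_itv/= lte_fin.
move: Ix; rewrite /intI/= in_itv/= => /andP[-> _].
by rewrite -EFinB/=; lra.
Qed.

Let normr x : I x -> memH (\1_(`]x, 1[) : R -> R) /\ hnorm (\1_(`]x, 1[) : R -> R) = Num.sqrt (1 - x).
Proof.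
move=> Ix; have [//||m n] := @hnorm_indic `]x, 1[%classic; first exact: subr.
split => //; rewrite -[LHS]ger0_norm ?hnorm_ge0// -sqrtr_sqr n.
congr Num.sqrt; rewrite lebesgue_measure_itv/= lte_fin.
by move: Ix; rewrite /intI/= in_itv/= => /andP[_ ->].
Qed.

Lemma primB g f x : memH g -> memH f -> I x ->
  prim (fun z => g z - f z) x = prim g x - prim f x.
Proof.
move=> mg mf Ix; have [m1 _] := norml Ix.
rewrite /prim -RintegralB//; [|by case: (memH_mul mg m1)|by case: (memH_mul mf m1)].
by apply: eq_Rintegral => z _; rewrite mulrBl.
Qed.

(** The primitive vanishes at both end points, and is estimated by the inequality
of Cauchy and Schwarz from the nearer one. *)
Lemma le_prim g x : memH g -> \int[mu]_(z in I) g z = 0 -> I x ->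
  `|prim g x| <= hnorm g * Num.sqrt (1 - `|x|).
Proof.
move=> mg g0 Ix; have [ml nl] := norml Ix; have [mr nr] := normr Ix.
have [x0|x0] := leP 0 x; last first.
  by rewrite (ltr0_norm x0) opprK -nl; exact: le_hnorm_int.
rewrite (ger0_norm x0) -nr; suff -> : prim g x = - \int[mu]_(z in I) (g z * \1_`]x, 1[ z).
  by rewrite normrN; exact: le_hnorm_int.
apply/eqP; rewrite -subr_eq0 opprK -RintegralD//; [|by case: (memH_mul mg ml)|by case: (memH_mul mg mr)].
rewrite -[X in _ == X]g0; apply/eqP/eq_Rintegral => z; rewrite inE /intI/= in_itv/= => /andP[z1 z2].
rewrite -mulrDr !indicE !mem_setE !in_itv/= z1 z2/= andbT.
by case: leP => _; rewrite ?addr0 ?add0r mulr1.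
Qed.

Lemma test_fun_prim phi x : test_fun I phi -> I x -> prim (derive1 phi) x = phi x.
Proof.
move=> tphi Ix; have [dphi cphi _] := tphi.
have -> : prim (derive1 phi) x = \int[mu]_(z in I) ((derive1 phi) \_ `]-1, x]) z.
  by apply: eq_Rintegral => z _; rewrite patch_indic.
rewrite -Rintegral_mkcondr.
rewrite setIidr; last exact: subl.
have x1 : -1 < x by move: Ix; rewrite /intI/= in_itv/= => /andP[].
have ic : mu.-integrable `[-1, x] (EFin \o derive1 phi).
  apply: continuous_compact_integrable; first exact: segment_compact.
  exact: continuous_subspaceT.
rewrite Rintegral_itv_obnd_cbnd; last by apply: integrableS ic => //; apply: subset_itvr; rewrite bnd_simp.
rewrite C1_Rintegral//; last by move=> z _; exact: cphi.
rewrite (@test_fun_out phi (-1))// ?subr0//.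
by rewrite /intI/= in_itv/= ltxx.
Qed.

Lemma test_fun_int0 phi : test_fun I phi -> \int[mu]_(z in I) derive1 phi z = 0.
Proof.
move=> tphi; have [dphi cphi _] := tphi.
have ic : mu.-integrable `[-1, 1] (EFin \o derive1 phi).
  apply: continuous_compact_integrable; first exact: segment_compact.
  exact: continuous_subspaceT.
rewrite /intI Rintegral_itv_bndo_bndc; last first.
  by apply: integrableS ic => //; exact: subset_itv_oo_cc.
rewrite Rintegral_itv_obnd_cbnd; last by apply: integrableS ic => //; apply: subset_itvr; rewrite bnd_simp.
rewrite C1_Rintegral//; last by move=> z _; exact: cphi.
rewrite (@test_fun_out phi (-1))// ?(@test_fun_out phi 1)// ?subrr//.
  by rewrite /intI/= in_itv/= ltxx andbF.
by rewrite /intI/= in_itv/= ltxx.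
Qed.

End primitive.

(** * Derivatives of elements of H^1_0 *)

Section domain.
Context {R : realType}.
Local Notation mu := (@lebesgue_measure R).
Local Notation I := (@intI R).
Implicit Types (u p f g phi : R -> R).
Hint Resolve measurable_I : core.

Lemma open_I : open I.
Proof. exact: interval_open. Qed.

Lemma continuous_I_measurable f :
  (forall x, I x -> {for x, continuous f}) -> measurable_fun I f.
Proof.
move=> cf; apply: open_continuous_measurable_fun; first exact: open_I.
by move=> x; rewrite inE; exact: cf.
Qed.

(** The difference is the primitive of an element of H with zero mean, so that it
decays at the end points as in [le_prim]. *)
Lemma le_prim_approx g phi x : memH g -> \int[mu]_(z in I) g z = 0 ->
  test_fun I phi -> I x ->
  `|prim g x - phi x| <= hnorm (fun z => g z - derive1 phi z) * Num.sqrt (1 - `|x|).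
Proof.
move=> mg g0 tphi Ix; have [_ mphi] := test_fun_memH tphi.
rewrite -(test_fun_prim tphi Ix) -primB//; apply: le_prim => //.
  exact: memHB.
rewrite RintegralB//; [|exact: memH_integrable..].
by rewrite g0 test_fun_int0// subr0.
Qed.

Lemma sqrt_le1 (x : R) : Num.sqrt (1 - `|x|) <= 1.
Proof. by rewrite -[leRHS]sqrtr1 ler_wsqrtr// lerBlDr lerDl. Qed.

(** The derivatives g of elements of H^1_0: limits in H of derivatives of test
functions, the corresponding element of H^1_0 being [prim g].  The zero mean
says that [prim g] vanishes at 1. *)
Record flux g : Prop := Flux {
  flux_memH : memH g;
  flux_int0 : \int[mu]_(z in I) g z = 0;
  flux_approx : forall e : R, 0 < e -> exists2 phi, test_fun I phi &
    hnorm (fun z => g z - derive1 phi z) < e }.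

Lemma fluxB g h : flux g -> flux h -> flux (fun z => g z - h z).
Proof.
move=> [mg g0 ag] [mh h0 ah]; split; first exact: memHB.
  rewrite RintegralB//; [|exact: memH_integrable..].
  by rewrite g0 h0 subr0.
move=> e e0; have e20 : 0 < e / 2 by rewrite divr_gt0.
have [phi tphi phie] := ag _ e20; have [psi tpsi psie] := ah _ e20.
have [_ mphi] := test_fun_memH tphi; have [_ mpsi] := test_fun_memH tpsi.
have [dphi cphi [K [cK KI K0]]] := tphi.
have [dpsi cpsi [L [cL LI L0]]] := tpsi.
have dE : derive1 (fun x => phi x - psi x) = (fun x => derive1 phi x - derive1 psi x).
  by apply/funext => x; rewrite !derive1E -deriveB.
exists (fun x => phi x - psi x).
  split.
  - by move=> x; exact: derivableB.
  - by rewrite dE => x; apply: continuousB; [exact: cphi|exact: cpsi].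
  - exists (K `|` L); split; first exact: compactU.
    + by move=> x [/KI|/LI].
    + by move=> x KLx; rewrite K0 ?L0 ?subrr// => ?; apply: KLx; [right|left].
rewrite dE [e]splitr.
apply: le_lt_trans (ltrD phie psie).
apply: le_trans (le_hnormB _ _); [|exact: memHB..].
rewrite le_eqVlt; apply/orP; left; apply/eqP/eq_hnorm => x _; ring.
Qed.

(** A uniform limit of test functions. *)
Lemma flux_continuous g x : flux g -> I x -> {for x, continuous (prim g)}.
Proof.
move=> [mg g0 ag] Ix; apply/cvgrPdist_lt => e e0.
have e30 : 0 < e / 3 by rewrite divr_gt0.
have [phi tphi phie] := ag _ e30.
have cphi : {for x, continuous phi}.
  by apply/differentiable_continuous/derivable1_diffP; case: tphi.
have close y : I y -> `|prim g y - phi y| < e / 3.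
  move=> Iy; apply: le_lt_trans phie; apply: le_trans (le_prim_approx mg g0 tphi Iy) _.
  by rewrite ler_piMr ?hnorm_ge0// sqrt_le1.
near=> y.
have Iy : I y by near: y; exact: open_I.
have xy : `|phi x - phi y| < e / 3 by near: y; move/cvgrPdist_lt: cphi; exact.
rewrite (_ : _ - _ = (prim g x - phi x) - (prim g y - phi y) + (phi x - phi y)); last by ring.
apply: le_lt_trans (ler_normD _ _) _.
apply: le_lt_trans (lerD (ler_normB _ _) (lexx _)) _.
have := close _ Ix; have := close _ Iy; lra.
Unshelve. all: by end_near. Qed.

(** The norm of H^1_0 controls both p - phi and the distance of [prim g] to phi,
hence identifies p with [prim g]. *)
Lemma W1p0_flux p : W1p0 I 2%:E p ->
  flux (wderiv I 2%:E p) /\ ae_eq_on I p (prim (wderiv I 2%:E p)).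
Proof.
move=> [[mp exg] app]; set g := wderiv I 2%:E p.
have [mg _] : mem_Lp I 2%:E g /\ is_wderiv I p g by exact: getPex exg.
have {}app e : 0 < e -> exists2 phi, test_fun I phi &
    hnorm (fun x => p x - phi x) + hnorm (fun z => g z - derive1 phi z) < e.
  move=> e0; have [phi tphi H] := app _ e0; exists phi => //.
  have [mphi mphi'] := test_fun_memH tphi.
  by rewrite -lte_fin EFinD -!hnormE//; exact: memHB.
have g0 : \int[mu]_(z in I) g z = 0.
  apply/eqP; rewrite -normr_le0; apply/ler_addgt0Pr => e e0; rewrite add0r.
  have e20 : 0 < e / 2 by rewrite divr_gt0.
  have [phi tphi phie] := app _ e20.
  have [mphi mphi'] := test_fun_memH tphi.
  rewrite -[X in `|X|]subr0 -(test_fun_int0 tphi) -RintegralB//; [|exact: memH_integrable..].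
  have m1 : memH (fun=> 1 : R).
    by apply: (@memH_bounded _ _ 1) => // x _; rewrite normr1.
  have n1 : hnorm (fun=> 1 : R) <= 2.
    by rewrite -[leRHS]mulr1; apply: hnorm_bounded => // x _; rewrite normr1.
  have -> : \int[mu]_(x in I) (g x - derive1 phi x) = \int[mu]_(x in I) ((g x - derive1 phi x) * 1).
    by apply: eq_Rintegral => x _; rewrite mulr1.
  apply: le_trans (le_hnorm_int (memHB mg mphi') m1) _.
  have := hnorm_ge0 (fun x => p x - phi x); have := hnorm_ge0 (fun z => g z - derive1 phi z).
  have := hnorm_ge0 (fun=> 1 : R); nra.
have fg : flux g.
  split => // e e0; have [phi tphi phie] := app _ e0; exists phi => //.
  by apply: le_lt_trans phie; rewrite lerDr hnorm_ge0.
split => //.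
have mP : memH (prim g).
  apply: (@memH_bounded _ _ (hnorm g)).
    by apply: continuous_I_measurable => x Ix; exact: flux_continuous.
  move=> x Ix; apply: le_trans (le_prim mg g0 Ix) _.
  by rewrite ler_piMr ?hnorm_ge0// sqrt_le1.
suff H : hnorm (fun x => p x - prim g x) = 0.
  have := hnorm_eq0 (memHB mp mP) H.
  have aeF := ae_filter_ringOfSetsType mu.
  by apply: filterS => x H' /H' /eqP; rewrite subr_eq0 => /eqP.
apply/eqP; rewrite eq_le hnorm_ge0 andbT; apply/ler_addgt0Pr => e e0; rewrite add0r.
have e20 : 0 < e / 2 by rewrite divr_gt0.
have [phi tphi phie] := app _ e20.
have [mphi mphi'] := test_fun_memH tphi.
rewrite (@eq_hnorm _ _ (fun x => (p x - phi x) - (prim g x - phi x))); last first.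
  by move=> x _; ring.
apply: le_trans (le_hnormB _ _) _; [exact: memHB..|].
have : hnorm (fun x => prim g x - phi x) <= 2 * hnorm (fun z => g z - derive1 phi z).
  apply: hnorm_bounded; first exact: hnorm_ge0.
    by apply: memH_measurable; exact: memHB.
  move=> x Ix; apply: le_trans (le_prim_approx mg g0 tphi Ix) _.
  by rewrite ler_piMr ?hnorm_ge0// sqrt_le1.
have := hnorm_ge0 (fun x => p x - phi x); lra.
Qed.

End domain.

(** * Calculus of C^1 functions *)

Section calculus.
Context {R : realType}.

Lemma is_derive_eps (f : R -> R) (x c : R) :
  (forall e : R, 0 < e -> exists2 d : R, 0 < d & forall y, `|y - x| < d ->
     `|f y - f x - c * (y - x)| <= e * `|y - x|) ->
  is_derive x 1 f c.
Proof.
move=> fP.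
have H : h^-1 *: ((f \o shift x) (h *: (1 : R)) - f x) @[h --> (0 : R)^'] --> c.
  apply/cvgrPdist_le => e e0; have [d d0 dP] := fP _ e0.
  apply/nbhs_ballP; exists d => //= h; rewrite /ball/= sub0r normrN => hd h0.
  have := dP (h + x); rewrite addrK => /(_ hd) {}dP.
  rewrite -(@ler_pM2r _ `|h|) ?normr_gt0//.
  rewrite -normrM (_ : _ * h = - (f (h + x) - f x - c * h)) ?normrN//.
  rewrite (_ : h%:A = h :> R); last exact: mulr1.
  by rewrite /GRing.scale/=; field.
by split; [exact: cvgP H|exact: cvg_lim H].
Qed.

Lemma is_derive_scale (f : R -> R) (k x df : R) :
  is_derive x 1 f df -> is_derive x 1 (fun t => k * f t) (k * df).
Proof. by move=> fdf; exact: (@is_deriveZ _ _ _ f k x 1 df fdf). Qed.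

Lemma is_derive_mul (f g : R -> R) (x df dg : R) :
  is_derive x 1 f df -> is_derive x 1 g dg ->
  is_derive x 1 (fun t => f t * g t) (df * g x + f x * dg).
Proof.
move=> fd gd; rewrite addrC [df * _]mulrC.
exact: (@is_deriveM _ _ f g x 1 df dg fd gd).
Qed.

Lemma is_derive_continuous (f : R -> R) (x df : R) :
  is_derive x 1 f df -> {for x, continuous f}.
Proof. by move=> [fd _]; exact/differentiable_continuous/derivable1_diffP. Qed.

Lemma is_derive_max0_sqr (z : R) :
  is_derive z 1 (fun t : R => Num.max t 0 ^+ 2) (2 * Num.max z 0).
Proof.
apply: is_derive_eps => e e0; exists e => // y ye.
apply: (@le_trans _ _ (`|y - z| * `|y - z|)); last by rewrite ler_wpM2r// ltW.
rewrite -expr2 real_normK ?num_real// ler_norml.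
have yz := sqr_ge0 (y - z).
by case: (leP y 0) => y0; case: (leP z 0) => z0; apply/andP; split; nra.
Qed.

Lemma continuous_max0 (z : R) : {for z, continuous (fun t : R => Num.max t 0)}.
Proof.
apply/cvgrPdist_lt => e e0; apply/nbhs_ballP; exists e => //= y; rewrite /ball/=.
by case: (leP z 0) => z0; case: (leP y 0) => y0; rewrite ?ltr_norml => /andP[]; lra.
Qed.

End calculus.

(** * The domain of A, and dissipativity *)

Section dissipativity.
Context {R : realType}.
Local Notation mu := (@lebesgue_measure R).
Local Notation I := (@intI R).
Implicit Types (u p f g w phi : R -> R).
Hint Resolve measurable_I : core.

(** The pointwise content of w in D(A) with Aw = g: rho w' is the primitive of g
at every point of I.  Unlike the weak formulation, it is visibly linear in the
pair (w, g). *)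
Record dom w g : Prop := Dom {
  dom_memH : memH w;
  dom_flux : flux g;
  dom_derive : forall x, I x -> is_derive x 1 w (prim g x / rho x) }.

Lemma domB w g v h : dom w g -> dom v h ->
  dom (fun x => w x - v x) (fun x => g x - h x).
Proof.
move=> [mw fg dw] [mv fh dv]; split; [exact: memHB|exact: fluxB|move=> x Ix].
rewrite (primB (flux_memH fg) (flux_memH fh) Ix) mulrBl.
by have := dw _ Ix; have := dv _ Ix => ? ?; exact: is_deriveB.
Qed.

Lemma I_norm (x : R) : I x -> `|x| < 1.
Proof. by rewrite /intI/= in_itv/= ltr_norml. Qed.

Lemma rho_ge (x : R) : I x -> 1 - `|x| <= rho x.
Proof.
move=> /I_norm x1; rewrite /rho -real_normK ?num_real//.
by have := normr_ge0 x; nra.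
Qed.

Lemma rho_gt0 (x : R) : I x -> 0 < rho x.
Proof.
move=> Ix; apply: lt_le_trans (rho_ge Ix); rewrite subr_gt0; exact: I_norm.
Qed.

Lemma continuous_rho (x : R) : {for x, continuous (@rho R)}.
Proof.
apply: continuousB; first exact: cvg_cst.
exact: exprn_continuous.
Qed.

(** The relation rho u' = prim (Au), known almost everywhere, gives u' a
continuous representative on compact subintervals. *)
Lemma mem_DA_dom u : mem_DA u -> dom u (Aop u).
Proof.
move=> [mu_ lac pW]; have [fg pE] := W1p0_flux pW.
split => // x Ix; have := Ix; rewrite /intI/= in_itv/= => /andP[x1 x2].
(* midpoints of x and the two ends of I *)
pose a := (x - 1) / 2; pose b := (x + 1) / 2.
have abI y : a <= y <= b -> I y.
  by rewrite /intI/= in_itv/= /a /b => /andP[]; lra.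
apply: (@abs_cont_is_derive _ a b u (fun z => prim (Aop u) z / rho z)).
- by apply: lac; [rewrite /a /b; lra|move=> y; rewrite /= in_itv/=; exact: abI].
- move=> y /abI Iy; apply: continuousM; first exact: flux_continuous.
  apply: continuousV; first by rewrite gt_eqF// rho_gt0.
  exact: continuous_rho.
- have aeF := ae_filter_ringOfSetsType mu.
  apply: filterS pE => y H; rewrite /= in_itv/= => /andP[/ltW ay /ltW yb].
  have Iy : I y by apply: abI; rewrite ay.
  by rewrite /= -/(Aop u) -(H Iy) mulrC mulKf// gt_eqF// rho_gt0.
- by rewrite /a /b; lra.
Qed.

Lemma dom_continuous w g x : dom w g -> I x -> {for x, continuous w}.
Proof.
move=> d Ix; have ? := dom_derive d Ix.
by apply/differentiable_continuous/derivable1_diffP.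
Qed.

(** As |prim g| <= ||g|| sqrt(rho), the derivative of w is dominated by
||g|| / sqrt(1 - x^2), the derivative of ||g|| asin. *)
Lemma dom_osc w g x y : dom w g -> I x -> I y -> x <= y ->
  `|w y - w x| <= pi * hnorm g.
Proof.
move=> d Ix Iy xy; have [mg g0 _] := dom_flux d.
have betI z : x <= z <= y -> I z.
  move: Ix Iy; rewrite /intI/= !in_itv/= => /andP[x1 _] /andP[_ y1] /andP[xz zy].
  by rewrite (lt_le_trans x1)//= (le_lt_trans zy).
have I1 z : I z -> -1 < z < 1 by rewrite /intI/= in_itv/=.
have slope z : I z -> `|prim g z / rho z| <= hnorm g * (Num.sqrt (1 - z ^+ 2))^-1.
  move=> Iz; rewrite normrM normfV (gtr0_norm (rho_gt0 Iz)).
  have s0 : 0 < Num.sqrt (1 - z ^+ 2) by rewrite sqrtr_gt0; exact: rho_gt0.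
  rewrite ler_pdivrMr ?rho_gt0// -mulrA.
  rewrite -[rho z](@sqr_sqrtr _ (1 - z ^+ 2)) ?(ltW (rho_gt0 Iz))//.
  rewrite expr2 mulKf ?gt_eqF//.
  apply: le_trans (le_prim mg g0 Iz) _; rewrite ler_wpM2l ?hnorm_ge0//.
  by rewrite ler_wsqrtr//; exact: rho_ge.
have der (s : R) z : I z ->
    is_derive z 1 (fun t => hnorm g * asin t - s * w t)
      (hnorm g * (Num.sqrt (1 - z ^+ 2))^-1 - s * (prim g z / rho z)).
  move=> Iz; have dw := dom_derive d Iz; have das := is_derive1_asin (I1 _ Iz).
  by apply: is_deriveB; exact: is_derive_scale.
have mono (s : R) : `|s| = 1 -> s * (w y - w x) <= hnorm g * (asin y - asin x).
  move=> s1; have derxy z : z \in `]x, y[ ->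
      is_derive z 1 (fun t => hnorm g * asin t - s * w t)
      (hnorm g * (Num.sqrt (1 - z ^+ 2))^-1 - s * (prim g z / rho z)).
    by rewrite in_itv/= => /andP[xz zy]; apply/der/betI; rewrite !ltW.
  have [|c cxy E] := MVT_segment xy derxy.
    apply: derivable_within_continuous => z; rewrite in_itv/= => /betI Iz.
    by case: (der s z Iz).
  rewrite -subr_ge0.
  rewrite (_ : _ - _ = (hnorm g * asin y - s * w y) - (hnorm g * asin x - s * w x)); last by ring.
  rewrite E mulr_ge0 ?subr_ge0//.
  have Ic : I c by apply: betI; move: cxy; rewrite in_itv.
  apply: le_trans (slope _ Ic).
  by apply: le_trans (ler_norm _) _; rewrite normrM s1 mul1r.
have asin1 z : I z -> - (pi / 2) <= asin z <= pi / 2.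
  by move=> /I1/andP[z1 z2]; rewrite asin_geNpi2 ?asin_lepi2// !ltW.
have := asin1 _ Ix; have := asin1 _ Iy.
have := mono 1 (normr1 _); have := mono (-1) (normrN1 _); have := hnorm_ge0 g.
rewrite mul1r mulN1r => N0 m1 m2 /andP[y1 y2] /andP[x1 x2].
have le : hnorm g * (asin y - asin x) <= pi * hnorm g.
  by rewrite mulrC ler_wpM2r//; lra.
by rewrite ler_norml; apply/andP; split; lra.
Qed.

(** The oscillation is controlled by [dom_osc], and the mean value of |w| by its
norm in H. *)
Lemma dom_bounded w g x : dom w g -> I x -> `|w x| <= hnorm w + pi * hnorm g.
Proof.
move=> d Ix; have mw := dom_memH d.
have mc (c : R) : memH (fun=> c) by apply: (@memH_bounded _ _ `|c|).
have nc (c : R) : 0 <= c -> hnorm (fun=> c) <= 2 * c.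
  by move=> c0; apply: hnorm_bounded => // y _; rewrite ger0_norm.
pose c := pi * hnorm g.
have c0 : 0 <= c by rewrite mulr_ge0 ?pi_ge0 ?hnorm_ge0.
have le y : I y -> `|w x| - c <= `|w y|.
  move=> Iy; suff : `|w x - w y| <= c by have := lerB_dist (w x) (w y); lra.
  have [xy|/ltW yx] := leP x y; last exact: (dom_osc d).
  by rewrite distrC; exact: (dom_osc d).
have := le_Rintegral measurable_I (memH_integrable (mc (`|w x| - c)))
  (integrable_abse (memH_integrable mw)) le.
rewrite Rintegral_cst// [X in _ * fine X <= _]mu_I/= => H.
have [_ ] := memH_mul mw (mc 1).
have -> : \int[mu]_(y in I) `|w y * 1| = \int[mu]_(y in I) `|w y|.
  by apply: eq_Rintegral => y _; rewrite mulr1.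
have := nc 1 ler01; have := hnorm_ge0 w; rewrite -/c => ? ? ?; nra.
Qed.

Lemma compact_subset_I (K : set R) : compact K -> K `<=` I ->
  exists c : R, 0 < c < 1 /\ forall x, K x -> `|x| < c.
Proof.
move=> cK KI; have [->|/set0P K0] := eqVneq K set0.
  by exists (1 / 2); split => //; lra.
have [|x0 Kx0 xmax] := @compact_EVT_max _ _ (@Num.norm R R) K K0 cK.
  by apply: continuous_subspaceT; exact: norm_continuous.
have := I_norm (KI _ (set_mem Kx0)); have := normr_ge0 x0 => x00 x01.
exists ((1 + `|x0|) / 2); split; first lra.
by move=> x Kx; have := xmax x (mem_set Kx); lra.
Qed.

(** Formally, the integral is - 2 int rho w^+ (w')^2.  To avoid the boundary, g is
replaced by the derivative of a test function phi close to [prim g]: then the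
integral of (th(w) phi)' vanishes, with th(w) = (w^+)^2, and in
  (th(w) phi)' = 2 w^+ (P / rho) phi + th(w) phi',  where P = prim g,
the factor P phi / rho is at least - |P| |P - phi| / rho >= - ||g|| e, since both
|P| and |P - phi| carry a factor sqrt(1 - |x|) and 1 - |x| <= rho. *)
Lemma dom_dissipative w g : dom w g ->
  \int[mu]_(x in I) (Num.max (w x) 0 ^+ 2 * g x) <= 0.
Proof.
move=> d; have [mg g0 ag] := dom_flux d.
pose P x := prim g x; pose th (z : R) := Num.max z 0 ^+ 2.
pose M := hnorm w + pi * hnorm g; pose B := hnorm g.
have M0 : 0 <= M by rewrite addr_ge0 ?mulr_ge0 ?pi_ge0 ?hnorm_ge0.
have B0 : 0 <= B by exact: hnorm_ge0.
have wM x : I x -> 0 <= Num.max (w x) 0 <= M.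
  move=> Ix; rewrite le_max lexx orbT ge_max M0 andbT/=.
  exact: le_trans (ler_norm _) (dom_bounded d Ix).
have cth x : I x -> {for x, continuous (fun y => th (w y))}.
  move=> Ix; apply: (@continuous_comp _ _ _ w th); first exact: dom_continuous d Ix.
  exact: is_derive_continuous (is_derive_max0_sqr _).
have mth : measurable_fun I (fun x => th (w x)) by exact: continuous_I_measurable.
have thM x : I x -> `|th (w x)| <= M ^+ 2.
  move=> /wM/andP[w0 w1]; rewrite normrX lerXn2r ?nnegrE ?normr_ge0//.
  by rewrite ger0_norm.
have mthH : memH (fun x => th (w x)) by exact: memH_bounded thM.
suff key e : 0 < e -> \int[mu]_(x in I) (th (w x) * g x) <= (4 * M * B + hnorm (fun x => th (w x))) * e.
  apply/ler_addgt0Pr => e e0; rewrite add0r.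
  pose C := 4 * M * B + hnorm (fun x => th (w x)) + 1.
  have C0 : 0 < C by rewrite ltr_wpDl// addr_ge0 ?hnorm_ge0// !mulr_ge0.
  have := key (e / C) (divr_gt0 e0 C0); move/le_trans; apply.
  rewrite mulrA ler_pdivrMr// mulrC ler_pM2l// /C; lra.
move=> e0; have [phi tphi phie] := ag _ e0.
have [mphi mphi'] := test_fun_memH tphi.
have [dphi cphi [K [cK KI K0]]] := tphi.
have [c [/andP[c0 c1] Kc]] := compact_subset_I cK KI.
have cI x : - c <= x <= c -> I x.
  by rewrite /intI/= in_itv/= => /andP[]; lra.
have phi0 x : I x -> ~ `[- c, c]%classic x -> derive1 phi x = 0.
  move=> Ix /= /negP; rewrite in_itv/= => xc.
  have cx : c < `|x|.
    rewrite ltNge; apply: contra xc => xc.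
    by move: xc; rewrite ler_norml.
  have H : \forall y \near x, phi y = cst 0 y.
    apply/nbhs_ballP; exists (`|x| - c); first by rewrite /= subr_gt0.
    move=> y; rewrite /ball/= => xy; apply: K0 => /Kc.
    by have := lerB_dist x y; lra.
  by rewrite derive1E (near_eq_derive _ H) derive_cst.
(* the derivative of (w^+)^2 phi *)
pose D x := 2 * Num.max (w x) 0 * (P x / rho x) * phi x + th (w x) * derive1 phi x.
have dphi1 (x : R) : is_derive x 1 phi (derive1 phi x).
  by split; [exact: dphi|rewrite derive1E].
have dpsi (x : R) : I x -> is_derive x 1 (fun y => th (w y) * phi y) (D x).
  move=> Ix; have dth := is_derive1_comp (is_derive_max0_sqr (w x)) (dom_derive d Ix).
  exact: is_derive_mul dth (dphi1 x).
have cP x : I x -> {for x, continuous P} by exact: (flux_continuous (dom_flux d)).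
have cw x : I x -> {for x, continuous w} by exact: dom_continuous d.
have cphi0 (x : R) : {for x, continuous phi} by exact: is_derive_continuous (dphi1 x).
have crho x : I x -> {for x, continuous (fun y => (@rho R y)^-1)}.
  move=> Ix; apply: continuousV; first by rewrite gt_eqF// rho_gt0.
  exact: continuous_rho.
have cD x : I x -> {for x, continuous D}.
  move=> Ix; apply: (@continuousD _ _ _ (fun y => 2 * Num.max (w y) 0 * (P y / rho y) * phi y)).
    apply: continuousM; last exact: cphi0.
    apply: continuousM.
      apply: continuousM; first exact: cst_continuous.
      apply: (@continuous_comp _ _ _ w (fun z => Num.max z 0)); first exact: cw.
      exact: continuous_max0.
    by apply: continuousM; [exact: cP|exact: crho].
  by apply: continuousM; [exact: cth|exact: cphi].
have dpsiE (x : R) : I x -> derive1 (fun y => th (w y) * phi y) x = D x.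
  by move=> Ix; rewrite derive1E; apply: derive_val; exact: dpsi.
have phic : phi c = 0.
  by apply: K0 => /Kc; rewrite ger0_norm ?ltxx// ltW.
have phiNc : phi (- c) = 0.
  by apply: K0 => /Kc; rewrite normrN ger0_norm ?ltxx// ltW.
have cc : - c < c by lra.
have D0 : \int[mu]_(x in `[- c, c]) D x = 0.
  transitivity (\int[mu]_(x in `[- c, c]) derive1 (fun y => th (w y) * phi y) x).
    by apply: eq_Rintegral => x; rewrite inE/= in_itv/= => /cI Ix; rewrite dpsiE.
  rewrite C1_Rintegral//; first by rewrite phic phiNc !mulr0 subrr.
    by move=> x /cI Ix; case: (dpsi _ Ix).
  move=> x /cI Ix; rewrite /prop_for /continuous_at dpsiE//.
  apply: cvg_trans (cD _ Ix); apply: near_eq_cvg.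
  by have : \forall y \near x, I y by [exact: open_I]; apply: filterS => y Iy; rewrite dpsiE.
have Dge x : I x -> th (w x) * derive1 phi x - 2 * M * B * e <= D x.
  move=> Ix; rewrite /D addrC lerD2r.
  have r0 := rho_gt0 Ix.
  have s0 := sqrtr_ge0 (1 - `|x|).
  have s2 : Num.sqrt (1 - `|x|) ^+ 2 = 1 - `|x|.
    by rewrite sqr_sqrtr// subr_ge0 ltW// I_norm.
  have P1 : `|P x| <= B * Num.sqrt (1 - `|x|) by exact: le_prim.
  have P2 : `|P x - phi x| <= e * Num.sqrt (1 - `|x|).
    apply: le_trans (le_prim_approx mg g0 tphi Ix) _.
    by rewrite ler_wpM2r// ltW.
  have Pphi : - (B * e) <= P x / rho x * phi x.
    rewrite mulrAC ler_pdivlMr//.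
    have PP : `|P x| * `|P x - phi x| <= B * e * (1 - `|x|).
      rewrite -s2 (_ : B * e * _ = (B * Num.sqrt (1 - `|x|)) * (e * Num.sqrt (1 - `|x|))); last by ring.
      by rewrite ler_pM.
    have : - (`|P x| * `|P x - phi x|) <= P x * phi x.
      rewrite -normrM lerNl; apply: le_trans (ler_norm _).
      by have := sqr_ge0 (P x); lra.
    have : B * e * (1 - `|x|) <= B * e * rho x.
      by rewrite ler_wpM2l ?rho_ge// mulr_ge0// ltW.
    lra.
  have [w0 w1] := andP (wM _ Ix).
  rewrite -!mulrA [X in _ <= _ * (_ * X)]mulrA -mulrN ler_pM2l//.
  have Be0 : 0 <= B * e by rewrite mulr_ge0// ltW.
  by nra.
have iD : mu.-integrable `[- c, c] (EFin \o D).
  apply: continuous_compact_integrable; first exact: segment_compact.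
  by apply: continuous_in_subspaceT => y; rewrite inE/= in_itv/= => /cI; exact: cD.
have thphi : \int[mu]_(x in I) (th (w x) * derive1 phi x) <= 4 * M * B * e.
  have -> : \int[mu]_(x in I) (th (w x) * derive1 phi x) =
      \int[mu]_(x in `[- c, c]) (th (w x) * derive1 phi x).
    have Icc : I `&` `[- c, c] = `[- c, c]%classic.
      by apply: setIidr => y; rewrite /= in_itv/=; exact: cI.
    rewrite -Icc Rintegral_mkcondr; apply: eq_Rintegral => x; rewrite inE => Ix.
    rewrite patchE; case: ifPn => //; rewrite notin_setE => xc.
    by rewrite phi0// mulr0.
  have ic k : mu.-integrable `[- c, c] (EFin \o (fun=> k : R)).
    apply: continuous_compact_integrable; first exact: segment_compact.
    by apply: continuous_subspaceT; exact: cst_continuous.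
  apply: (@le_trans _ _ (\int[mu]_(x in `[- c, c]) (D x + 2 * M * B * e))).
    apply: le_Rintegral => //.
    - apply: continuous_compact_integrable; first exact: segment_compact.
      apply: continuous_in_subspaceT => y; rewrite inE/= in_itv/= => /cI Iy.
      have cc1 : {for y, continuous (fun x => th (w x) * derive1 phi x)}.
        by apply: continuousM; [exact: cth|exact: cphi].
      exact: cc1.
    - exact: (integrableD _ iD (ic _)).
    - by move=> x; rewrite /= in_itv/= => /cI /Dge; rewrite lerBlDr.
  rewrite RintegralD// D0 add0r Rintegral_cst//.
  have mcc : mu `[- c, c]%classic = (c + c)%:E.
    by rewrite lebesgue_measure_itv/= lte_fin cc -EFinB opprK.
  rewrite [X in _ * fine X <= _]mcc/=.
  have : 0 <= M * B * e by rewrite !mulr_ge0// ltW.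
  by nra.
have -> : \int[mu]_(x in I) (th (w x) * g x) =
   \int[mu]_(x in I) (th (w x) * derive1 phi x) +
   \int[mu]_(x in I) (th (w x) * (g x - derive1 phi x)).
  rewrite -RintegralD//; [|by case: (memH_mul mthH mphi')|by case: (memH_mul mthH (memHB mg mphi'))].
  by apply: eq_Rintegral => x _; ring.
rewrite mulrDl lerD//; apply: le_trans (ler_norm _) _.
apply: le_trans (le_hnorm_int mthH (memHB mg mphi')) _.
by rewrite ler_wpM2l ?hnorm_ge0// ltW.
Qed.

End dissipativity.

(** * Nondecreasing functions in W^{1,oo} are Lipschitz *)

Section lipschitz.
Context {R : realType}.
Local Notation mu := (@lebesgue_measure R).

Lemma ae_le_Rintegral (D : set R) (f1 f2 : R -> R) : measurable (D : set (measurableTypeR R)) ->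
  mu.-integrable D (EFin \o f1) -> mu.-integrable D (EFin \o f2) ->
  ae_le_on D f1 f2 -> \int[mu]_(x in D) f1 x <= \int[mu]_(x in D) f2 x.
Proof.
move=> mD i1 i2 f12.
have m1 : measurable_fun D f1 by apply/measurable_EFinP; case/integrableP: i1.
have m2 : measurable_fun D f2 by apply/measurable_EFinP; case/integrableP: i2.
have mm : measurable_fun D (fun x => Num.max (f1 x) (f2 x)) by exact: measurable_maxr.
have im : mu.-integrable D (EFin \o (fun x => Num.max (f1 x) (f2 x))).
  apply: (le_integrable mD _ _ (integrableD mD (integrable_abse i1) (integrable_abse i2))).
    exact/measurable_EFinP.
  move=> x _; rewrite /= lee_fin [leRHS]ger0_norm ?addr_ge0//.
  by case: (leP (f1 x) (f2 x)) => _; rewrite ?lerDl ?lerDr.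
have -> : \int[mu]_(x in D) f2 x = \int[mu]_(x in D) Num.max (f1 x) (f2 x).
  rewrite /Rintegral; congr fine; apply: ae_eq_integral => //; [exact/measurable_EFinP..|].
  have aeF := ae_filter_ringOfSetsType mu.
  by apply: filterS f12 => x H /H /max_idPr /= ->.
by apply: le_Rintegral => // x _; rewrite le_max lexx.
Qed.

Lemma ae_bounded_integrable (D : set R) (f : R -> R) (M : R) :
  measurable (D : set (measurableTypeR R)) -> (mu D < +oo)%E ->
  measurable_fun D f -> {ae mu, forall x, D x -> `|f x| <= M} ->
  mu.-integrable D (EFin \o f).
Proof.
move=> mD fD mf fM; apply/integrableP; split; first exact/measurable_EFinP.
apply: (@le_lt_trans _ _ (\int[mu]_(x in D) (`|M|)%:E)%E); last first.
  by rewrite integral_cst// lte_mul_pinfty.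
apply: ae_ge0_le_integral => //.
- by apply: measurableT_comp => //; exact/measurable_EFinP.
- have aeF := ae_filter_ringOfSetsType mu.
  by apply: filterS fM => x H /H fxM /=; rewrite lee_fin (le_trans fxM)// ler_norm.
Qed.

Lemma mem_Lpy_ae_bounded (D : set R) (f : R -> R) :
  measurable (D : set (measurableTypeR R)) -> mem_Lp D +oo%E f ->
  measurable_fun D f /\ exists2 M : R, 0 <= M & {ae mu, forall x, D x -> `|f x| <= M}.
Proof.
move=> mD /andP[]; rewrite !inE/= => mf fin; split.
  exact: (measurable_restrictT _ mD).2 mf.
have mT : (0 < mu [set: R])%E by rewrite -set_itvNyy lebesgue_measure_itv/= lt0y.
move: fin; rewrite /finite_norm unlock [X in if X then _ else _]mT.
move=> /ess_supr_bounded[M HM]; exists `|M| => //.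
have aeF := ae_filter_ringOfSetsType mu.
apply: filterS HM => x /= + Dx; rewrite patchE mem_set// => /le_trans; apply.
exact: ler_norm.
Qed.

(** A C^1 function rising from 0 to 1 on [0, 2h]: the second difference of the
squared positive part. *)
Definition step (h t : R) : R :=
  (2 * h ^+ 2)^-1 * (Num.max t 0 ^+ 2 - 2 * Num.max (t - h) 0 ^+ 2 + Num.max (t - 2 * h) 0 ^+ 2).

Definition dstep (h t : R) : R :=
  (h ^+ 2)^-1 * (Num.max t 0 - 2 * Num.max (t - h) 0 + Num.max (t - 2 * h) 0).

Lemma step0 h t : 0 < h -> t <= 0 -> step h t = 0 /\ dstep h t = 0.
Proof.
move=> h0 t0; rewrite /step /dstep.
rewrite (max_r t0) (max_r (_ : t - h <= 0)) ?(max_r (_ : t - 2 * h <= 0)); [|lra..].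
by split; ring.
Qed.

Lemma step1 h t : 0 < h -> 2 * h <= t -> step h t = 1 /\ dstep h t = 0.
Proof.
move=> h0 t0; rewrite /step /dstep.
rewrite (max_l (_ : 0 <= t)) ?(max_l (_ : 0 <= t - h)) ?(max_l (_ : 0 <= t - 2 * h)); [|lra..].
by split; field; rewrite gt_eqF.
Qed.

Lemma step_bounds h t : 0 < h -> 0 <= step h t <= 1 /\ 0 <= dstep h t.
Proof.
move=> h0; rewrite /step /dstep.
have h20 : 0 < h ^+ 2 by rewrite exprn_gt0.
suff [H1 H2 H3] : [/\ 0 <= Num.max t 0 ^+ 2 - 2 * Num.max (t - h) 0 ^+ 2 + Num.max (t - 2 * h) 0 ^+ 2,
   Num.max t 0 ^+ 2 - 2 * Num.max (t - h) 0 ^+ 2 + Num.max (t - 2 * h) 0 ^+ 2 <= 2 * h ^+ 2 &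
   0 <= Num.max t 0 - 2 * Num.max (t - h) 0 + Num.max (t - 2 * h) 0].
  split; last by rewrite mulr_ge0// invr_ge0 ltW.
  rewrite mulr_ge0 ?invr_ge0//=; last by rewrite mulr_ge0 ?ltW.
  by rewrite ler_pdivrMl ?mulr_gt0// mulr1.
by case: (leP t 0) => t0; case: (leP (t - h) 0) => t1; case: (leP (t - 2 * h) 0) => t2; split; nra.
Qed.

Lemma is_derive_shift (f : R -> R) (a t c : R) :
  is_derive (t - a) 1 f c -> is_derive t 1 (fun x => f (x - a)) c.
Proof.
move=> fc; have H : is_derive t 1 (fun x : R => x - a) 1.
  by apply: is_derive_eq; rewrite subr0.
by have := @is_derive1_comp R f (fun x => x - a) t _ _ fc H; rewrite mulr1.
Qed.

Lemma is_derive_step (h t : R) : 0 < h -> is_derive t 1 (step h) (dstep h t).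
Proof.
move=> h0.
have sq (a : R) : is_derive t 1 (fun x : R => Num.max (x - a) 0 ^+ 2) (2 * Num.max (t - a) 0).
  exact: is_derive_shift (is_derive_max0_sqr (t - a)).
have sq0 := is_derive_max0_sqr t.
have -> : dstep h t = (2 * h ^+ 2)^-1 * (2 * Num.max t 0 - 2 * (2 * Num.max (t - h) 0) +
    2 * Num.max (t - 2 * h) 0).
  by rewrite /dstep; field; rewrite gt_eqF.
exact: (is_derive_scale (2 * h ^+ 2)^-1
  (is_deriveD (is_deriveB sq0 (is_derive_scale 2 (sq h))) (sq (2 * h)))).
Qed.

Lemma continuous_dstep (h : R) : continuous (dstep h).
Proof.
move=> t; have cm (a : R) : {for t, continuous (fun x : R => Num.max (x - a) 0)}.
  apply: (@continuous_comp _ _ _ (fun x : R => x - a) (fun z => Num.max z 0)).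
    by apply: continuousB; [exact: cvg_id|exact: cvg_cst].
  exact: continuous_max0.
have c0 := @continuous_max0 R t.
have ck (k : R) : {for t, continuous (cst k : R -> R)} by exact: cvg_cst.
have c2 := @continuousM _ _ _ _ t (ck 2) (cm h).
exact: (@continuousM _ _ _ _ t (ck (h ^+ 2)^-1)
  (continuousD (continuousB c0 c2) (cm (2 * h)))).
Qed.

(** A bound at every point, not just almost everywhere: test the weak derivative
against a smoothed indicator of [x, y] that rises before x and falls after y.
Then int beta phi' is an average of beta over the left of x minus an average over
the right of y, hence at most beta x - beta y by monotonicity, while the weak
derivative g gives int beta phi' = - int g phi >= - L (y - x + 4h). *)
Lemma nondecreasing_W1py_lipschitz (beta : R -> R) : W1p setT +oo%E beta ->
  {homo beta : x y / x <= y} ->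
  exists2 L : R, 0 <= L & forall x y, x <= y -> beta y - beta x <= L * (y - x).
Proof.
move=> [mb [g [mg wg]]] ndb.
have [mbeta _] := mem_Lpy_ae_bounded measurableT mb.
have [mgT [L L0 gL]] := mem_Lpy_ae_bounded measurableT mg.
exists L => // x y xy.
suff key (h : R) : 0 < h -> beta y - beta x <= L * (y - x + 4 * h).
  apply/ler_addgt0Pr => e e0; pose C := 4 * (L + 1).
  have C0 : 0 < C by rewrite mulr_gt0// ltr_wpDl.
  have := key (e / C) (divr_gt0 e0 C0); move/le_trans; apply.
  rewrite mulrDr lerD2l !mulrA ler_pdivrMr// mulrC ler_pM2l// /C; lra.
move=> h0; pose A := x - 2 * h; pose B := y + 2 * h.
have AB : A < B by rewrite /A /B; lra.
(* equal to 1 on [x, y], with support in [A, B] = [x - 2h, y + 2h] *)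
pose phi z := step h (z - A) - step h (z - y).
pose dphi z := dstep h (z - A) - dstep h (z - y).
have dstepS (a z : R) : is_derive z 1 (fun t => step h (t - a)) (dstep h (z - a)).
  exact: is_derive_shift (is_derive_step (z - a) h0).
have cdstepS (a : R) : continuous (fun t => dstep h (t - a)).
  move=> z; apply: (@continuous_comp _ _ _ (fun t : R => t - a) (dstep h)).
    by apply: continuousB; [exact: cvg_id|exact: cvg_cst].
  exact: continuous_dstep.
have dphiP (z : R) : is_derive z 1 phi (dphi z) by exact: is_deriveB.
have dphiE : derive1 phi = dphi.
  by apply/funext => z; rewrite derive1E derive_val.
have cdphi : continuous dphi by move=> z; exact: (continuousB (cdstepS A z) (cdstepS y z)).
have cphi : continuous phi by move=> z; exact: is_derive_continuous (dphiP z).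
have out z : ~ `[A, B]%classic z -> phi z = 0 /\ dphi z = 0.
  rewrite /= in_itv/= => /negP; rewrite negb_and -!ltNge /phi /dphi => /orP[zA|zB].
    have [-> ->] := @step0 h (z - A) h0 ltac:(lra).
    by have [-> ->] := @step0 h (z - y) h0 ltac:(rewrite /A in zA; lra); rewrite !subr0.
  have [-> ->] := @step1 h (z - A) h0 ltac:(rewrite /A; rewrite /B in zB; lra).
  by have [-> ->] := @step1 h (z - y) h0 ltac:(rewrite /B in zB; lra); rewrite !subrr.
have phi01 z : 0 <= phi z <= 1.
  rewrite /phi; have [/andP[s0 s1] _] := step_bounds (z - A) h0.
  have [/andP[t0 t1] _] := step_bounds (z - y) h0.
  have [zy|yz] := leP z y.
    by have [-> _] := @step0 h (z - y) h0 ltac:(lra); rewrite subr0 s0.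
  have [-> _] := @step1 h (z - A) h0 ltac:(rewrite /A; lra).
  by apply/andP; split; lra.
have tphi : test_fun setT phi.
  split; first by move=> z; case: (dphiP z).
    by rewrite dphiE.
  exists `[A, B]%classic; split => //; first exact: segment_compact.
  by move=> z /out[].
have mAB : measurable (`[A, B]%classic : set (measurableTypeR R)) by exact: measurable_itv.
have muAB : (mu `[A, B]%classic) = (B - A)%:E.
  by rewrite lebesgue_measure_itv/= lte_fin AB -EFinB.
have muABoo : (mu `[A, B]%classic < +oo)%E by rewrite muAB ltry.
have toAB (f : R -> R) : (forall z, ~ `[A, B]%classic z -> f z = 0) ->
    \int[mu]_(z in setT) f z = \int[mu]_(z in `[A, B]) f z.
  move=> f0; rewrite [RHS]Rintegral_mkcond; apply: eq_Rintegral => z _.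
  rewrite patchE; case: ifPn => //; rewrite notin_setE; exact: f0.
have mphi : measurable_fun setT phi by exact: continuous_measurable_fun.
have mdphi : measurable_fun setT dphi by exact: continuous_measurable_fun.
have := wg phi tphi; rewrite dphiE toAB; last by move=> z /out[_ ->]; rewrite mulr0.
rewrite toAB; last by move=> z /out[-> _]; rewrite mulr0.
move=> E.
have igphi : mu.-integrable `[A, B] (EFin \o (fun z => g z * phi z)).
  apply: (@ae_bounded_integrable _ _ L) => //.
    by apply: measurable_funTS; exact: measurable_funM.
  have aeF := ae_filter_ringOfSetsType mu.
  apply: filterS gL => z /(_ Logic.I) gz _; rewrite normrM.
  have /andP[p0 p1] := phi01 z; rewrite (ger0_norm p0).
  by have := normr_ge0 (g z); nra.
have icst k : mu.-integrable `[A, B] (EFin \o (fun=> k : R)).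
  by apply: (@ae_bounded_integrable _ _ `|k|) => //; exact: aeW.
have le1 : \int[mu]_(z in `[A, B]) (g z * phi z) <= L * (B - A).
  rewrite -[B - A]/(fine (B - A)%:E) -muAB -Rintegral_cst//.
  apply: ae_le_Rintegral => //.
  have aeF := ae_filter_ringOfSetsType mu.
  apply: filterS gL => z /(_ Logic.I) gz _.
  have /andP[p0 p1] := phi01 z.
  by have := ler_norm (g z); have := normr_ge0 (g z); nra.
(* its derivative dominates beta * dphi by monotonicity *)
pose psi z := beta x * step h (z - A) - beta y * step h (z - y).
pose dpsi z := beta x * dstep h (z - A) - beta y * dstep h (z - y).
have dpsiP (z : R) : is_derive z 1 psi (dpsi z).
  by apply: is_deriveB; exact: is_derive_scale.
have dpsiE : derive1 psi = dpsi.
  by apply/funext => z; rewrite derive1E derive_val.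
have cdpsi : continuous dpsi.
  move=> z; have ck (k : R) : {for z, continuous (cst k : R -> R)} by exact: cvg_cst.
  exact: (continuousB (continuousM (ck (beta x)) (cdstepS A z))
    (continuousM (ck (beta y)) (cdstepS y z))).
have intpsi : \int[mu]_(z in `[A, B]) dpsi z = beta x - beta y.
  rewrite -dpsiE C1_Rintegral//; last by move=> z _; rewrite dpsiE; exact: cdpsi.
  rewrite /psi.
  have [-> _] := @step1 h (B - A) h0 ltac:(rewrite /A /B; lra).
  have [-> _] := @step1 h (B - y) h0 ltac:(rewrite /B; lra).
  have [-> _] := @step0 h (A - A) h0 ltac:(lra).
  have [-> _] := @step0 h (A - y) h0 ltac:(rewrite /A; lra).
  by rewrite !mulr1 !mulr0 !subr0.
have le2 : \int[mu]_(z in `[A, B]) (beta z * dphi z) <= \int[mu]_(z in `[A, B]) dpsi z.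
  apply: le_Rintegral => //.
  - have bdphi : mu.-integrable `[A, B] (EFin \o dphi).
      apply: continuous_compact_integrable; first exact: segment_compact.
      exact: continuous_subspaceT.
    apply: (le_integrable mAB _ _ (integrableZl mAB (`|beta A| + `|beta B|) bdphi)).
      apply/measurable_EFinP; apply: measurable_funTS; exact: measurable_funM.
    move=> z; rewrite /= in_itv/= => /andP[Az zB]; rewrite lee_fin !normrM ler_wpM2r//.
    rewrite [leRHS]ger0_norm ?addr_ge0// ler_norml.
    have := ndb _ _ Az; have := ndb _ _ zB.
    have := ler_norm (beta B); have := ler_norm (- beta A); rewrite normrN.
    have := normr_ge0 (beta A); have := normr_ge0 (beta B).
    by move=> *; apply/andP; split; lra.
  - apply: continuous_compact_integrable; first exact: segment_compact.
    exact: continuous_subspaceT.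
  - move=> z _; rewrite /dphi /dpsi mulrBr.
    have [_ s0] := step_bounds (z - A) h0; have [_ t0] := step_bounds (z - y) h0.
    have c1 : beta z * dstep h (z - A) <= beta x * dstep h (z - A).
      have [zx|/ltW xz] := leP z x; first by rewrite ler_wpM2r// ndb.
      by have [_ ->] := @step1 h (z - A) h0 ltac:(rewrite /A; lra); rewrite !mulr0.
    have c2 : beta y * dstep h (z - y) <= beta z * dstep h (z - y).
      have [yz|/ltW zy] := leP y z; first by rewrite ler_wpM2r// ndb.
      by have [_ ->] := @step0 h (z - y) h0 ltac:(lra); rewrite !mulr0.
    lra.
rewrite intpsi E in le2.
by move: le1 le2; rewrite /A /B; nra.
Qed.

End lipschitz.

(** * The energy of the positive part *)

Section energy.
Context {R : realType}.
Local Notation mu := (@lebesgue_measure R).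
Local Notation I := (@intI R).
Hint Resolve measurable_I : core.
Local Notation pos z := (Num.max z 0).

(** Taylor formula for the C^2 function (z^+)^3, whose second derivative is at most
6M on [-M, M]. *)
Lemma pos_cube_remainder (M z y : R) : `|z| <= M -> `|y| <= M ->
  `|pos y ^+ 3 - pos z ^+ 3 - 3 * pos z ^+ 2 * (y - z)| <= 3 * M * (y - z) ^+ 2.
Proof.
rewrite !ler_norml => /andP[z1 z2] /andP[y1 y2].
case: (leP y 0) => y0; case: (leP z 0) => z0.
- have h : 0 <= M * (y - z) ^+ 2 by rewrite mulr_ge0 ?sqr_ge0//; lra.
  by apply/andP; split; lra.
- have h1 : 0 <= (M - z) * z * z by rewrite !mulr_ge0 ?subr_ge0// ltW.
  have h2 : 0 <= (M - z) * z * - y by rewrite !mulr_ge0 ?subr_ge0 ?oppr_ge0// ltW.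
  have h3 : 0 <= z * z * z by rewrite !mulr_ge0// ltW.
  have h4 : 0 <= z * z * - y by rewrite !mulr_ge0 ?oppr_ge0// ltW.
  have h5 : 0 <= M * y * y by rewrite -mulrA mulr_ge0 ?sqr_ge0//; lra.
  have h6 : 0 <= M * z * - y by rewrite !mulr_ge0 ?oppr_ge0//; lra.
  by apply/andP; split; rewrite ?expr2 ?exprS ?expr0; lra.
- have h1 : 0 <= (M - y) * y * y by rewrite !mulr_ge0 ?subr_ge0// ltW.
  have h3 : 0 <= y * y * y by rewrite !mulr_ge0// ltW.
  have h5 : 0 <= M * z * z by rewrite -mulrA mulr_ge0 ?sqr_ge0//; lra.
  have h6 : 0 <= M * y * - z by rewrite !mulr_ge0 ?oppr_ge0//; lra.
  have h7 : 0 <= M * y * y by rewrite !mulr_ge0//; lra.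
  by apply/andP; split; rewrite ?expr2 ?exprS ?expr0; lra.
- have h1 : 0 <= (M - y) * (y - z) ^+ 2 by rewrite mulr_ge0 ?subr_ge0 ?sqr_ge0.
  have h2 : 0 <= (M - z) * (y - z) ^+ 2 by rewrite mulr_ge0 ?subr_ge0 ?sqr_ge0.
  have h3 : 0 <= (y + 2 * z) * (y - z) ^+ 2 by rewrite mulr_ge0 ?sqr_ge0//; lra.
  by apply/andP; split; move: h1 h2 h3; rewrite ?expr2 ?exprS ?expr0; lra.
Qed.

Lemma pos_cube_lipschitz (M z y : R) : `|z| <= M -> `|y| <= M ->
  `|pos y ^+ 3 - pos z ^+ 3| <= 3 * M ^+ 2 * `|y - z|.
Proof.
have posM t : `|t| <= M -> 0 <= pos t <= M.
  move=> tM; rewrite le_max lexx orbT ge_max (le_trans (ler_norm _) tM)/=.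
  exact: le_trans tM.
move=> /posM/andP[z0 z1] /posM/andP[y0 y1].
have pl : `|pos y - pos z| <= `|y - z|.
  have p1 := ler_norm (y - z); have p2 := ler_norm (z - y); rewrite distrC in p2.
  have p3 := normr_ge0 (y - z).
  by rewrite ler_norml; case: (leP y 0) => y2; case: (leP z 0) => z2; apply/andP; split; lra.
move: (pos y) (pos z) z0 z1 y0 y1 pl => a b b0 b1 a0 a1 pl.
rewrite subrXX !big_ord_recl big_ord0 /= normrM mulrC.
rewrite ler_pM// ger0_norm; last by rewrite !addr_ge0// ?mulr_ge0// ?exprn_ge0.
rewrite /bump/=; nra.
Qed.

Definition energy (w : R -> R) : R := \int[mu]_(x in I) (pos (w x) ^+ 3).

Lemma measurable_pos (w : R -> R) n : measurable_fun I w ->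
  measurable_fun I (fun x => pos (w x) ^+ n).
Proof.
by move=> mw; apply: measurable_funX; apply: measurable_maxr => //; exact: measurable_cst.
Qed.

Lemma pos_bound (M z : R) n : `|z| <= M -> `|pos z ^+ n| <= M ^+ n.
Proof.
move=> zM; have M0 : 0 <= M by exact: le_trans zM.
rewrite normrX lerXn2r ?nnegrE ?normr_ge0//.
by rewrite ger0_norm ?le_max ?lexx ?orbT// ge_max M0 (le_trans (ler_norm _) zM).
Qed.

Lemma memH_pos (w : R -> R) (M : R) n : measurable_fun I w ->
  (forall x, I x -> `|w x| <= M) -> memH (fun x => pos (w x) ^+ n).
Proof.
move=> mw wM; apply: (@memH_bounded _ _ (M ^+ n)); first exact: measurable_pos.
by move=> x /wM; exact: pos_bound.
Qed.

Lemma energy_lipschitz (w v : R -> R) (M : R) : 0 <= M -> memH w -> memH v ->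
  (forall x, I x -> `|w x| <= M) -> (forall x, I x -> `|v x| <= M) ->
  `|energy v - energy w| <= 6 * M ^+ 2 * hnorm (fun x => v x - w x).
Proof.
move=> M0 mw mv wM vM.
have iw := memH_integrable (memH_pos 3 (memH_measurable mw) wM).
have iv := memH_integrable (memH_pos 3 (memH_measurable mv) vM).
have m1 : memH (fun=> 3 * M ^+ 2 : R) by apply: (@memH_bounded _ _ `|3 * M ^+ 2|).
rewrite /energy -RintegralB//.
have mB := memHB mv mw.
apply: le_trans (le_normr_Rintegral _ _) _ => //; first exact: (integrableB measurable_I iv iw).
have [imul le] := memH_mul m1 mB.
apply: (@le_trans _ _ (\int[mu]_(x in I) `|3 * M ^+ 2 * (v x - w x)|)).
  apply: le_Rintegral => //.
  - exact: (integrable_abse (integrableB measurable_I iv iw)).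
  - exact: (integrable_abse imul).
  - move=> x Ix; rewrite normrM [X in X * _]ger0_norm ?mulr_ge0 ?sqr_ge0//.
    by apply: pos_cube_lipschitz; [exact: wM|exact: vM].
apply: le_trans le _; rewrite ler_wpM2r ?hnorm_ge0//.
rewrite (_ : 6 * M ^+ 2 = 2 * (3 * M ^+ 2)); last by ring.
apply: hnorm_bounded => //; first by rewrite mulr_ge0// sqr_ge0.
by move=> x _; rewrite ger0_norm// mulr_ge0// sqr_ge0.
Qed.

Lemma energy_remainder (w v : R -> R) (M : R) : 0 <= M -> memH w -> memH v ->
  (forall x, I x -> `|w x| <= M) -> (forall x, I x -> `|v x| <= M) ->
  `|energy v - energy w - 3 * \int[mu]_(x in I) (pos (w x) ^+ 2 * (v x - w x))|
  <= 3 * M * hnorm (fun x => v x - w x) ^+ 2.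
Proof.
move=> M0 mw mv wM vM.
have iw := memH_integrable (memH_pos 3 (memH_measurable mw) wM).
have iv := memH_integrable (memH_pos 3 (memH_measurable mv) vM).
have mB := memHB mv mw.
have [im _] := memH_mul (memH_pos 2 (memH_measurable mw) wM) mB.
have i3 := integrableZl measurable_I 3 im.
have ivw := integrableB measurable_I iv iw.
rewrite /energy -RintegralZl// -RintegralB// -RintegralB//.
have itot := integrableB measurable_I ivw i3.
apply: le_trans (le_normr_Rintegral _ _) _ => //.
have i2 := hnorm_sqr_integrable mB.
rewrite hnorm_sqr// -RintegralZl//.
apply: le_Rintegral => //.
- exact: (integrable_abse itot).
- exact: (integrableZl measurable_I (3 * M) i2).
- by move=> x Ix; rewrite mulrA; apply: pos_cube_remainder; [exact: wM|exact: vM].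
Qed.

(** The curve is differentiable in H only, while the energy is cubic: the uniform
bound M makes the Taylor remainder quadratic in the norm of H. *)
Lemma energy_is_derive (W : R -> R -> R) (V : R -> R) (t d0 M : R) : 0 < d0 -> 0 <= M ->
  memH V ->
  (forall s, `|s - t| < d0 -> memH (W s) /\ forall x, I x -> `|W s x| <= M) ->
  (forall e : R, 0 < e -> exists2 d, 0 < d & forall s, s != t -> `|s - t| < d ->
     hnorm (fun x => (s - t)^-1 * (W s x - W t x) - V x) < e) ->
  is_derive t 1 (fun s => energy (W s)) (3 * \int[mu]_(x in I) (pos (W t x) ^+ 2 * V x)).
Proof.
move=> d00 M0 mV WM WV; apply: is_derive_eps => e e0.
have [mWt WtM] : memH (W t) /\ forall x, I x -> `|W t x| <= M.
  by apply: WM; rewrite subrr normr0.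
have mp := memH_pos 2 (memH_measurable mWt) WtM.
pose K := hnorm (fun x => pos (W t x) ^+ 2).
have K0 : 0 <= K by exact: hnorm_ge0.
pose N := hnorm V.
have N0 : 0 <= N by exact: hnorm_ge0.
(* half of the error e comes from the approximation of the difference quotient,
   half from the quadratic remainder *)
pose e1 := Num.min 1 (e / (6 * (K + 1))).
have K10 : 0 < 6 * (K + 1) by rewrite mulr_gt0// ltr_wpDl.
have e10 : 0 < e1 by rewrite lt_min ltr01 divr_gt0.
have [d1 d10 d1P] := WV _ e10.
pose C := 6 * M * (N + 1) ^+ 2 + 1.
have C0 : 0 < C by rewrite ltr_wpDl// !mulr_ge0 ?addr_ge0.
exists (Num.min d0 (Num.min d1 (e / C))); first by rewrite !lt_min d00 d10 divr_gt0.
move=> s; rewrite !lt_min => /and3P[sd0 sd1 sdC].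
have [->|st] := eqVneq s t; first by rewrite !subrr mulr0 subrr normr0 mulr0.
have [mWs WsM] := WM _ sd0.
have st0 : s - t != 0 by rewrite subr_eq0.
have := d1P _ st sd1; rewrite /e1 lt_min => /andP[q1 q2].
set Q := fun x => _ in q1 q2.
have mB := memHB mWs mWt.
have mQ : memH Q by apply: memHB => //; exact: memHZ.
have nD : hnorm (fun x => W s x - W t x) <= `|s - t| * (N + 1).
  rewrite (@eq_hnorm _ _ (fun x => (s - t) * (Q x + V x))); last first.
    by move=> x _; rewrite /Q subrK mulVKf.
  rewrite hnormZ; last exact: memHD.
  rewrite ler_wpM2l// (le_trans (le_hnormD mQ mV))// addrC lerD2l.
  exact: ltW.
have r1 := energy_remainder M0 mWt mWs WtM WsM.
have [im _] := memH_mul mp mB; have [iV _] := memH_mul mp mV; have [iQ _] := memH_mul mp mQ.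
have E : \int[mu]_(x in I) (pos (W t x) ^+ 2 * (W s x - W t x)) =
    (s - t) * \int[mu]_(x in I) (pos (W t x) ^+ 2 * V x) +
    (s - t) * \int[mu]_(x in I) (pos (W t x) ^+ 2 * Q x).
  rewrite -mulrDr -RintegralD// -RintegralZl//; last exact: (integrableD measurable_I iV iQ).
  by apply: eq_Rintegral => x _; rewrite /Q; field.
have r2 := le_hnorm_int mp mQ.
rewrite E in r1.
set X := \int[mu]_(x in I) (pos (W t x) ^+ 2 * V x) in r1 *.
set Y := \int[mu]_(x in I) (pos (W t x) ^+ 2 * Q x) in r1 r2 *.
set Z := energy (W s) - energy (W t) in r1 *.
rewrite (_ : Z - _ = (Z - 3 * ((s - t) * X + (s - t) * Y)) + 3 * (s - t) * Y); last by ring.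
apply: le_trans (ler_normD _ _) _.
apply: le_trans (lerD r1 (lexx _)) _.
rewrite !normrM (ger0_norm (ler0n _ 3)).
have s0 := normr_ge0 (s - t).
have YK : 6 * `|Y| <= e.
  move: q2; rewrite ltr_pdivlMr// => q2.
  have : `|Y| <= K * hnorm Q by exact: r2.
  have := hnorm_ge0 Q; nra.
have nD2 : hnorm (fun x => W s x - W t x) ^+ 2 <= `|s - t| ^+ 2 * (N + 1) ^+ 2.
  by rewrite -exprMn lerXn2r ?nnegrE ?hnorm_ge0// mulr_ge0// addr_ge0.
have b1 : 3 * M * hnorm (fun x => W s x - W t x) ^+ 2 <= `|s - t| * (e / 2).
  apply: (@le_trans _ _ (`|s - t| * (`|s - t| * (3 * M * (N + 1) ^+ 2)))).
    rewrite (_ : `|s - t| * _ = 3 * M * (`|s - t| ^+ 2 * (N + 1) ^+ 2)); last by ring.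
    by rewrite ler_wpM2l// mulr_ge0.
  rewrite ler_wpM2l//.
  have := ltW sdC; rewrite ler_pdivlMr// /C.
  have : 0 <= `|s - t| by [].
  by lra.
have b2 : 3 * `|s - t| * `|Y| <= `|s - t| * (e / 2).
  by rewrite mulrAC mulrC ler_wpM2l//; lra.
by lra.
Qed.

End energy.

(** * Regular curves *)

Section time.
Context {R : realType}.
Local Notation mu := (@lebesgue_measure R).
Local Notation I := (@intI R).
Hint Resolve measurable_I : core.
Implicit Types (J : set R) (U : R -> R -> R) (b : \bar R).

Lemma eps_within_continuous (f : R -> R) (a b : R) :
  (forall t, a <= t <= b -> forall e : R, 0 < e -> exists2 d : R, 0 < d &
    forall s, a <= s <= b -> `|s - t| < d -> `|f s - f t| < e) ->
  {within `[a, b], continuous f}.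
Proof.
move=> H; apply/subspace_continuousP => t; rewrite /= in_itv/= => /H {}H.
apply/cvgrPdist_lt => e /H[d d0 dP]; apply/nbhs_ballP; exists d => //= s.
rewrite /ball/= distrC => sd; rewrite in_itv/= => sab; rewrite distrC; exact: dP.
Qed.

Lemma normH_cvg0 (F : set_system R) (f : R -> R -> R) (e : R) : Filter F -> 0 < e ->
  normH (f s) @[s --> F] --> 0%E -> F [set s | (normH (f s) < e%:E)%E].
Proof.
move=> FF e0 f0.
have H : nbhs (0%E : \bar R) [set y | (y < e%:E)%E].
  exact: (@nbhs_open_ereal_lt R 0 (fun=> e) e0).
exact: (f0 _ H).
Qed.

Lemma contH_eps J U t : contH J U -> J t -> forall e : R, 0 < e ->
  exists2 d : R, 0 < d & forall s, J s -> `|s - t| < d ->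
    hnorm (fun x => U s x - U t x) < e.
Proof.
move=> cU Jt e e0; have [mt /(normH_cvg0 _ e0)] := cU _ Jt.
move=> /nbhs_ballP[d /= d0 dP]; exists d => // s Js st.
rewrite -lte_fin -hnormE; last by apply: memHB => //; case: (cU _ Js).
by apply: dP => //; rewrite /ball/= distrC.
Qed.

Lemma tderiv_eps J U t : C1H J U -> J t -> memH (tderiv J U t) /\
  forall e : R, 0 < e -> exists2 d : R, 0 < d & forall s, J s -> s != t -> `|s - t| < d ->
    hnorm (fun x => (s - t)^-1 * (U s x - U t x) - tderiv J U t x) < e.
Proof.
move=> [C1 _] Jt; have [mt exv] := C1 _ Jt.
have [mv cv] : is_tderiv J U t (tderiv J U t) by exact: getPex exv.
split => // e e0; have H : nbhs t [set s | s != t -> J s ->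
    (normH (fun x => ((s - t)^-1 * (U s x - U t x) - tderiv J U t x)%R) < e%:E)%E].
  exact: normH_cvg0 _ e0 cv.
have /nbhs_ballP[d /= d0 dP] := H; exists d => // s Js st sd.
rewrite -lte_fin -hnormE; last first.
  apply: memHB => //; apply: memHZ; apply: memHB => //; by case: (C1 _ Js).
by apply: dP => //; rewrite /ball/= distrC.
Qed.

Lemma tint_le b s t : tint b t -> 0 <= s -> s <= t -> tint b s.
Proof.
move=> [t0 tb] s0 st; split => //; apply: le_lt_trans tb; by rewrite lee_fin.
Qed.

Lemma contH_bounded b U (T : R) : contH (tint b) U -> tint b T ->
  exists2 C : R, 0 <= C & forall t, 0 <= t <= T -> hnorm (U t) <= C.
Proof.
move=> cU bT; have [T0 _] := bT.
have [|c _ cmax] := @EVT_max R (fun t => hnorm (U t)) 0 T T0.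
  apply: eps_within_continuous => t /andP[t0 tT] e e0.
  have bt := tint_le bT t0 tT.
  have [d d0 dP] := contH_eps cU bt e0; exists d => // s /andP[s0 sT] st.
  have bs := tint_le bT s0 sT.
  apply: le_lt_trans (dP _ bs st).
  by apply: le_hnorm_diff; [case: (cU _ bs)|case: (cU _ bt)].
exists (hnorm (U c)); first exact: hnorm_ge0.
by move=> t tT; apply: cmax; rewrite in_itv.
Qed.

(** The graph norm is bounded on [0, T], and it dominates the sup norm. *)
Lemma contDA_bounded b U (T : R) : contDA (tint b) U -> tint b T ->
  exists2 M : R, 0 <= M & forall t x, 0 <= t <= T -> I x -> `|U t x| <= M.
Proof.
move=> [DA cU cA] bT; have [C C0 CP] := contH_bounded cU bT.
have [D D0 DP] := contH_bounded cA bT.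
exists (C + pi * D); first by rewrite addr_ge0 ?mulr_ge0 ?pi_ge0.
move=> t x /andP[t0 tT] Ix; have bt := tint_le bT t0 tT.
apply: le_trans (dom_bounded (mem_DA_dom (DA _ bt)) Ix) _.
by rewrite lerD ?CP ?t0// ler_wpM2l ?pi_ge0// DP ?t0.
Qed.

Lemma tint_nbhs b (T t : R) : tint b T -> 0 < t < T ->
  exists2 d : R, 0 < d & forall s, `|s - t| < d -> 0 <= s <= T /\ tint b s.
Proof.
move=> bT /andP[t0 tT]; exists (Num.min t (T - t)); first by rewrite lt_min t0 subr_gt0.
move=> s; rewrite lt_min !ltr_norml => /andP[/andP[s1 s2] /andP[s3 s4]].
have sT : 0 <= s <= T by apply/andP; split; lra.
by split => //; case/andP: sT; exact: tint_le.
Qed.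

Lemma energy_diff_continuous b1 b2 U V (T : R) :
  contDA (tint b1) U -> contDA (tint b2) V -> tint b1 T -> tint b2 T ->
  {within `[0, T], continuous (fun t => energy (fun x => U t x - V t x))}.
Proof.
move=> DU DV b1T b2T; have [M M0 UM] := contDA_bounded DU b1T.
have [M' M'0 VM] := contDA_bounded DV b2T.
have [_ cU _] := DU; have [_ cV _] := DV.
apply: eps_within_continuous => t /andP[t0 tT] e e0.
have b1t := tint_le b1T t0 tT; have b2t := tint_le b2T t0 tT.
pose K := 6 * (M + M') ^+ 2 + 1.
have K0 : 0 < K by rewrite ltr_wpDl// mulr_ge0// exprn_ge0// addr_ge0.
have e20 : 0 < e / (2 * K) by rewrite divr_gt0// mulr_gt0.
have [d d0 dP] := contH_eps cU b1t e20; have [d' d'0 dP'] := contH_eps cV b2t e20.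
exists (Num.min d d'); first by rewrite lt_min d0.
move=> s /andP[s0 sT]; rewrite lt_min => /andP[sd sd'].
have b1s := tint_le b1T s0 sT; have b2s := tint_le b2T s0 sT.
have mUs : memH (U s) by case: (cU _ b1s). have mUt : memH (U t) by case: (cU _ b1t).
have mVs : memH (V s) by case: (cV _ b2s). have mVt : memH (V t) by case: (cV _ b2t).
have bnd r x : 0 <= r <= T -> I x -> `|U r x - V r x| <= M + M'.
  by move=> rT Ix; apply: le_trans (ler_normB _ _) _; rewrite lerD ?UM ?VM.
have := @energy_lipschitz _ (fun x => U t x - V t x) (fun x => U s x - V s x) (M + M').
move=> /(_ (addr_ge0 M0 M'0) (memHB mUt mVt) (memHB mUs mVs)).
move=> /(_ (fun x => bnd t x _) (fun x => bnd s x _)).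
rewrite t0 s0 tT sT => /(_ isT isT); move/le_lt_trans; apply.
rewrite (@eq_hnorm _ _ (fun x => (U s x - U t x) - (V s x - V t x))); last first.
  by move=> x _; ring.
have := le_hnormB (memHB mUs mUt) (memHB mVs mVt).
have := dP _ b1s sd; have := dP' _ b2s sd'.
set a := hnorm (fun x => U s x - U t x); set c := hnorm (fun x => V s x - V t x).
set n := hnorm _ => cK aK nac.
have n0 : 0 <= n by exact: hnorm_ge0.
have nK : n < e / K.
  have -> : e / K = e / (2 * K) + e / (2 * K) by field; rewrite gt_eqF.
  lra.
move: nK; rewrite ltr_pdivlMr// /K; nra.
Qed.

Lemma energy_diff_is_derive b1 b2 U V (T t : R) :
  C1H (tint b1) U -> C1H (tint b2) V -> contDA (tint b1) U -> contDA (tint b2) V ->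
  tint b1 T -> tint b2 T -> 0 < t < T ->
  is_derive t 1 (fun t => energy (fun x => U t x - V t x))
    (3 * \int[mu]_(x in I) (Num.max (U t x - V t x) 0 ^+ 2 *
       (tderiv (tint b1) U t x - tderiv (tint b2) V t x))).
Proof.
move=> C1U C1V DU DV b1T b2T tT; have [M M0 UM] := contDA_bounded DU b1T.
have [M' M'0 VM] := contDA_bounded DV b2T.
have [_ cU _] := DU; have [_ cV _] := DV.
have [d1 d10 d1P] := tint_nbhs b1T tT; have [d2 d20 d2P] := tint_nbhs b2T tT.
have b1t : tint b1 t by case: (d1P t); rewrite // subrr normr0.
have b2t : tint b2 t by case: (d2P t); rewrite // subrr normr0.
have [mdU dU] := tderiv_eps C1U b1t; have [mdV dV] := tderiv_eps C1V b2t.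
have mU s : tint b1 s -> memH (U s) by move=> /cU[].
have mV s : tint b2 s -> memH (V s) by move=> /cV[].
apply: (@energy_is_derive _ (fun t x => U t x - V t x) _ t (Num.min d1 d2) (M + M')).
- by rewrite lt_min d10.
- exact: addr_ge0.
- exact: memHB.
- move=> s; rewrite lt_min => /andP[/d1P[sT b1s] /d2P[_ b2s]]; split.
    by apply: memHB; [exact: mU|exact: mV].
  by move=> x Ix; apply: le_trans (ler_normB _ _) _; rewrite lerD ?UM ?VM.
- move=> e e0; have e20 : 0 < e / 2 by rewrite divr_gt0.
  have [d3 d30 d3P] := dU _ e20; have [d4 d40 d4P] := dV _ e20.
  exists (Num.min (Num.min d1 d2) (Num.min d3 d4)); first by rewrite !lt_min d10 d20 d30.
  move=> s st; rewrite !lt_min => /andP[/andP[/d1P[_ b1s] /d2P[_ b2s]] /andP[sd3 sd4]].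
  have := d3P _ b1s st sd3; have := d4P _ b2s st sd4.
  set p := (fun x => _ in X in X -> _); set q := (fun x => _ in X in _ -> X -> _).
  move=> np nq.
  have mp : memH p by apply: memHB => //; apply: memHZ; apply: memHB; exact: mV.
  have mq : memH q by apply: memHB => //; apply: memHZ; apply: memHB; exact: mU.
  rewrite (@eq_hnorm _ _ (fun x => q x - p x)); last by move=> x _; rewrite /p /q; ring.
  apply: le_lt_trans (le_hnormB mq mp) _; rewrite [e]splitr; exact: ltrD.
Qed.

End time.

(** * The reaction terms and Gronwall's inequality *)

Section reaction.
Context {R : realType}.
Local Notation pos z := (Num.max z 0).
Local Notation quartic z := (`|z| ^+ 3 * z).

(** Monotonicity gives the radiative terms their sign, the Lipschitz bound on
bounded sets their size. *)
Lemma quartic_variation (M v u : R) : `|v| <= M -> `|u| <= M -> v <= u ->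
  0 <= quartic u - quartic v <= 4 * M ^+ 3 * (u - v).
Proof.
have aux (x y : R) : 0 <= x -> x <= y -> y <= M ->
    0 <= y ^+ 3 * y - x ^+ 3 * x <= 4 * M ^+ 3 * (y - x).
  move=> x0 xy yM; have y0 : 0 <= y by exact: le_trans xy.
  have M0 : 0 <= M by exact: le_trans yM.
  have xM := le_trans xy yM.
  have yx : 0 <= y - x by rewrite subr_ge0.
  have -> : y ^+ 3 * y - x ^+ 3 * x = (y ^+ 3 + y ^+ 2 * x + y * x ^+ 2 + x ^+ 3) * (y - x).
    by ring.
  have b (i j : nat) : 0 <= y ^+ i * x ^+ j <= M ^+ i * M ^+ j.
    by rewrite mulr_ge0 ?exprn_ge0//= ler_pM ?exprn_ge0// lerXn2r// nnegrE.
  have /andP[h1 h2] := b 3 0; have /andP[h3 h4] := b 2 1.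
  have /andP[h5 h6] := b 1 2; have /andP[h7 h8] := b 0 3.
  apply/andP; split; first by rewrite mulr_ge0//; lra.
  by rewrite ler_wpM2r//; lra.
move=> vM uM vu; case: (leP 0 v) => v0.
  have u0 : 0 <= u by exact: le_trans vu.
  rewrite (ger0_norm v0) (ger0_norm u0); apply: aux => //.
  exact: le_trans (ler_norm _) uM.
case: (leP 0 u) => u0; last first.
  rewrite (ltr0_norm v0) (ltr0_norm u0).
  have /aux : 0 <= - u by lra.
  move=> /(_ (- v)); rewrite lerN2 => /(_ vu).
  rewrite -(ltr0_norm v0) => /(_ vM); rewrite ltr0_norm// => /andP[h1 h2].
  by apply/andP; split; lra.
have M0 : 0 <= M by exact: le_trans uM.
have /andP[h1 h2] : 0 <= quartic u - 0 <= 4 * M ^+ 3 * (u - 0).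
  have := aux 0 u (lexx _) u0; rewrite !mulr0 ger0_norm//; apply.
  exact: le_trans (ler_norm _) uM.
have /andP[h3 h4] : 0 <= `|v| ^+ 3 * `|v| - 0 <= 4 * M ^+ 3 * (`|v| - 0).
  by have := aux 0 `|v| (lexx _) (normr_ge0 _) vM; rewrite !mulr0.
move: h3 h4; rewrite [X in _ * X - 0]ltr0_norm// [X in _ * (X - 0)]ltr0_norm// => h3 h4.
by apply/andP; split; lra.
Qed.

(** The common form of the two brackets, with (u, v) the values of the equation's
own unknown and (s, z) those of the other.  Where u > v, the terms - la (u - v)
and - d (...) have the good sign; the coupling terms are at most a multiple of
(s - z)^+ because they are nondecreasing in s. *)
Lemma reaction_cooperative (la c d k K L M u v s z : R) (beta : R -> R) :
  0 <= la -> 0 <= c -> 0 <= d -> 0 <= k <= K -> 0 <= L ->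
  (forall x y, x <= y -> beta y - beta x <= L * (y - x)) ->
  `|u| <= M -> `|v| <= M -> `|s| <= M -> `|z| <= M ->
  pos (u - v) ^+ 2 * (- la * ((u - v) - (s - z)) + c * (quartic s - quartic z)
     - d * (quartic u - quartic v) + k * (beta u - beta v)) <=
  (la + 4 * M ^+ 3 * c + K * L) * (pos (u - v) ^+ 3 + pos (s - z) ^+ 3).
Proof.
move=> la0 c0 d0 /andP[k0 kK] L0 betaL uM vM sM zM.
have M0 : 0 <= M by exact: le_trans uM.
have K0 : 0 <= K by exact: le_trans kK.
have A0 : 0 <= la + 4 * M ^+ 3 * c by rewrite addr_ge0// !mulr_ge0// exprn_ge0.
have B0 : 0 <= K * L by rewrite mulr_ge0.
have p0 : 0 <= pos (s - z) by rewrite le_max lexx orbT.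
case: (leP (u - v) 0) => [_|uv].
  by rewrite !expr0n/= mul0r add0r mulr_ge0 ?exprn_ge0//; lra.
have vu : v <= u by lra.
have /andP[q1 _] := quartic_variation vM uM vu.
have qs : quartic s - quartic z <= 4 * M ^+ 3 * pos (s - z).
  case: (leP (s - z) 0) => sz.
    have sz' : s <= z by lra.
    by have /andP[+ _] := quartic_variation sM zM sz'; lra.
  have sz' : z <= s by lra.
  by have /andP[] := quartic_variation zM sM sz'.
have sp : s - z <= pos (s - z) by rewrite le_max lexx.
set a := u - v in uv *; set p := pos (s - z) in p0 qs sp *.
have h1 : 0 <= d * (quartic u - quartic v) by exact: mulr_ge0.
have h2 := ler_wpM2l c0 qs.
have h3 : k * (beta u - beta v) <= K * L * a.
  apply: (@le_trans _ _ (k * (L * a))); first by rewrite ler_wpM2l// betaL.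
  by rewrite mulrA ler_wpM2r ?(ltW uv)// ler_wpM2r.
have h4 := ler_wpM2l la0 sp.
have h5 : 0 <= la * a by rewrite mulr_ge0// ltW.
apply: (@le_trans _ _ (a ^+ 2 * ((la + 4 * M ^+ 3 * c) * p + K * L * a))).
  by rewrite ler_wpM2l ?sqr_ge0//; lra.
(* Young's inequality *)
have h6 : a ^+ 2 * p <= a ^+ 3 + p ^+ 3.
  have : 0 <= (a - p) ^+ 2 * (a + p) by rewrite mulr_ge0 ?sqr_ge0// addr_ge0// ltW.
  have : 0 <= a * p ^+ 2 by rewrite mulr_ge0 ?sqr_ge0// ltW.
  have : 0 <= a ^+ 3 by rewrite exprn_ge0// ltW.
  have : 0 <= p ^+ 3 by rewrite exprn_ge0.
  have : 0 <= a * (a - p) ^+ 2 by rewrite mulr_ge0 ?sqr_ge0// ltW.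
  have : 0 <= p * (a - p) ^+ 2 by rewrite mulr_ge0 ?sqr_ge0.
  rewrite ?expr2 ?exprS ?expr0; lra.
have h7 := ler_wpM2l A0 h6.
have h8 : 0 <= K * L * p ^+ 3 by rewrite mulr_ge0// exprn_ge0.
by lra.
Qed.

(** The function E(t) exp(- K t) is nonincreasing. *)
Lemma gronwall (E E' : R -> R) (K T : R) : 0 <= T ->
  {within `[0, T], continuous E} ->
  (forall t : R, 0 < t < T -> is_derive t 1 E (E' t) /\ E' t <= K * E t) ->
  E T <= E 0 * expR (K * T).
Proof.
move=> T0 cE dE.
pose F t := E t * expR (- K * t).
have dexp (t : R) : is_derive t 1 (fun t => expR (- K * t)) (- K * expR (- K * t)).
  have -> : - K * expR (- K * t) = (- K * 1) * expR (- K * t) by rewrite mulr1.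
  apply: is_derive_eq; rewrite /GRing.scale/=; ring.
have dF (t : R) : 0 < t < T -> is_derive t 1 F ((E' t - K * E t) * expR (- K * t)).
  move=> /dE[dEt _]; apply: is_derive_eq.
  rewrite /GRing.scale/=; ring.
have -> : E 0 = F 0 by rewrite /F mulr0 expR0 mulr1.
have ET : E T = F T * expR (K * T) by rewrite /F -mulrA -expRD mulNr addNr expR0 mulr1.
rewrite ET ler_wpM2r ?expR_ge0//.
apply: (@ler0_derive1_nincr _ F 0 T) => //.
- by move=> t; rewrite in_itv/= => /dF[].
- move=> t; rewrite in_itv/= => tT; have [d e] := dF t tT.
  rewrite derive1E e mulr_le0_ge0 ?expR_ge0// subr_le0.
  by have [] := dE t tT.
- have cexp : continuous (fun t => expR (- K * t)).
    by move=> s; have ? := dexp s; apply/differentiable_continuous/derivable1_diffP.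
  have cexpT := @continuous_subspaceT _ _ [set` `[0, T]] _ cexp.
  by move=> t; exact: cvgM (cE t) (cexpT t).
Qed.

End reaction.

(** * Energy and the operator *)

Section energy_domain.
Context {R : realType}.
Local Notation mu := (@lebesgue_measure R).
Local Notation I := (@intI R).
Hint Resolve measurable_I : core.
Local Notation pos z := (Num.max z 0).

Lemma pos_ge0 (z : R) n : 0 <= pos z ^+ n.
Proof. by rewrite exprn_ge0// le_max lexx orbT. Qed.

Lemma energy_ge0 (w : R -> R) : 0 <= energy w.
Proof. by apply: Rintegral_ge0 => x _; exact: pos_ge0. Qed.

Lemma dom_bound w g : dom w g -> exists M : R, forall x, I x -> `|w x| <= M.
Proof. by move=> d; exists (hnorm w + pi * hnorm g) => x; exact: dom_bounded. Qed.

Lemma dom_pos_integrable w g n : dom w g -> mu.-integrable I (EFin \o (fun x => pos (w x) ^+ n)).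
Proof.
move=> d; have [M wM] := dom_bound d.
exact: memH_integrable (memH_pos n (memH_measurable (dom_memH d)) wM).
Qed.

Lemma energy_eq0 w g : dom w g -> ae_le_on I w (fun=> 0) -> energy w = 0.
Proof.
move=> d w0; apply/eqP; rewrite eq_le energy_ge0 andbT.
have -> : 0 = \int[mu]_(x in I) (0 : R) by rewrite Rintegral_cst// mul0r.
apply: ae_le_Rintegral => //; first exact: dom_pos_integrable d.
  by apply: (@bounded_integrable _ _ 0) => // z _; rewrite normr0.
have aeF := ae_filter_ringOfSetsType mu.
by apply: filterS w0 => x wx /wx wx0; rewrite (max_idPr wx0) expr0n.
Qed.

(** Positivity at one point propagates to a neighbourhood by continuity. *)
Lemma energy_le0 w g x : dom w g -> energy w <= 0 -> I x -> w x <= 0.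
Proof.
move=> d w0 Ix; rewrite leNgt; apply/negP => wx.
have near_x : \forall z \near x, I z /\ w x / 2 < w z.
  near=> z; split; first by near: z; exact: open_nbhs_nbhs (conj open_I Ix).
  near: z; apply: (cvgr_gt (w x)); first exact: dom_continuous d Ix.
  by lra.
have /nbhs_ballP[e /= e0 eP] := near_x.
pose A : set R := `]x - e, x + e[%classic.
have mA : measurable (A : set (measurableTypeR R)) by exact: measurable_itv.
have AP z : A z -> I z /\ w x / 2 < w z.
  by move=> Az; apply: eP; rewrite ball_itv.
have AI : A `<=` I by move=> z /AP[].
have [m1 n1] := hnorm_indic mA AI.
have muA : mu A = (2 * e)%:E.
  rewrite /A lebesgue_measure_itv/= lte_fin.
  have -> : (x - e < x + e) = true by lra.
  by rewrite -EFinB; congr EFin; ring.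
move: n1; rewrite muA/= hnorm_sqr// => n1.
suff : (w x / 2) ^+ 3 * (2 * e) <= energy w.
  apply/negP; rewrite -ltNge; apply: le_lt_trans w0 _.
  by rewrite !mulr_gt0// exprn_gt0// divr_gt0.
have i1 := hnorm_sqr_integrable m1.
rewrite -n1 -RintegralZl//; apply: le_Rintegral => //.
- exact: (integrableZl measurable_I _ i1).
- exact: dom_pos_integrable d.
- move=> z _; rewrite indicE; case: (boolP (z \in A)) => zA.
    rewrite expr1n mulr1; have [_ wz] := AP _ (set_mem zA).
    rewrite lerXn2r// ?nnegrE ?le_max ?(ltW wz)//; last by rewrite lexx orbT.
    by rewrite divr_ge0// ltW.
  by rewrite expr0n/= mulr0 pos_ge0.
Unshelve. all: by end_near. Qed.

(** The diffusion term is dropped by dissipativity. *)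
Lemma parabolic_estimate w g v h (V : R -> R) (gam kap C : R) : 0 <= gam -> 0 <= kap ->
  dom w g -> dom v h -> memH V ->
  ae_le_on I (fun x => pos (w x) ^+ 2 * (gam * (V x - kap * g x)))
    (fun x => C * (pos (w x) ^+ 3 + pos (v x) ^+ 3)) ->
  gam * \int[mu]_(x in I) (pos (w x) ^+ 2 * V x) <= C * (energy w + energy v).
Proof.
move=> gam0 kap0 dw dv mV wV; have [M wM] := dom_bound dw.
have mp := memH_pos 2 (memH_measurable (dom_memH dw)) wM.
have [iV _] := memH_mul mp mV.
have [ig _] := memH_mul mp (flux_memH (dom_flux dw)).
have igk := integrableZl measurable_I (gam * kap) ig.
have iVg := integrableZl measurable_I gam iV.
have iw := dom_pos_integrable 3 dw; have iv := dom_pos_integrable 3 dv.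
have iwv := integrableD measurable_I iw iv.
have iC := integrableZl measurable_I C iwv.
have iR := integrableD measurable_I igk iC.
rewrite -RintegralZl// /energy -RintegralD// -RintegralZl//.
apply: (@le_trans _ _ (\int[mu]_(x in I) (gam * kap * (pos (w x) ^+ 2 * g x) +
    C * (pos (w x) ^+ 3 + pos (v x) ^+ 3)))).
  apply: ae_le_Rintegral => //.
  have aeF := ae_filter_ringOfSetsType mu.
  apply: filterS wV => x wVx Ix; have := wVx Ix.
  move: (pos (w x) ^+ 2) (C * _) => a b; lra.
rewrite RintegralD// RintegralZl// gerDr.
by rewrite mulr_ge0_le0 ?mulr_ge0//; exact: dom_dissipative.
Qed.

End energy_domain.

(** * Comparison of sub-solutions and super-solutions *)

Section comparison.
Context {R : realType}.
Local Notation mu := (@lebesgue_measure R).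
Local Notation I := (@intI R).
Hint Resolve measurable_I : core.
Local Notation pos z := (Num.max z 0).
Variable P : ebm_data R.
Hypotheses (gamma_a_gt0 : 0 < gamma_a P) (gamma_s_gt0 : 0 < gamma_s P)
  (kappa_a_gt0 : 0 < kappa_a P) (kappa_s_gt0 : 0 < kappa_s P)
  (sigma_B_gt0 : 0 < sigma_B P) (eps_a_gt0 : 0 < eps_a P)
  (lambda_ge0 : 0 <= lambda P)
  (beta_a_W : W1p setT +oo%E (beta_a P))
  (beta_s_W : W1p setT +oo%E (beta_s P))
  (beta_a_nd : {homo beta_a P : x y / x <= y})
  (beta_s_nd : {homo beta_s P : x y / x <= y})
  (q_bounded : mem_Lp intI +oo%E (q P))
  (q_ge0 : forall x, intI x -> 0 <= q P x)
  (r_gt0 : forall t, 0 < t -> 0 < r P t)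
  (r_bounded : [bounded r P t | t in [set t : R | 0 < t]]).

Lemma forcing_bounded : exists2 K : R, 0 <= K & forall t, 0 < t ->
  {ae mu, forall x, I x -> 0 <= r_ext P t * q P x <= K}.
Proof.
have [_ [Q Q0 qQ]] := mem_Lpy_ae_bounded measurable_I q_bounded.
have [B [_ BP]] := r_bounded.
pose K := `|B| + 1.
have rK t : 0 < t -> `|r P t| <= K.
  move=> t0; apply: (BP K) => //.
  by rewrite /K (le_lt_trans (ler_norm _))// ltrDl.
have K0 : 0 <= K by rewrite addr_ge0.
exists (K * Q); first exact: mulr_ge0.
move=> t t0; have aeF := ae_filter_ringOfSetsType mu.
apply: filterS qQ => x qx Ix; rewrite /r_ext t0.
have r0 := ltW (r_gt0 t0); have q0 := q_ge0 Ix.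
rewrite mulr_ge0//= ler_pM//.
  exact: le_trans (ler_norm _) (rK _ t0).
exact: le_trans (ler_norm _) (qx Ix).
Qed.

(** As r is bounded, C can be chosen uniformly in time; the exceptional
set comes from q, which is bounded almost everywhere. *)
Lemma bracket_cooperative (M : R) : 0 <= M -> exists2 C : R, 0 <= C &
  forall (t : R) (u v : (R -> R) * (R -> R)), 0 < t ->
  (forall x, I x -> [/\ `|u.1 x| <= M, `|v.1 x| <= M, `|u.2 x| <= M & `|v.2 x| <= M]) ->
  {ae mu, forall x, I x ->
    pos (u.1 x - v.1 x) ^+ 2 * (bracket_a P t u x - bracket_a P t v x) <=
      C * (pos (u.1 x - v.1 x) ^+ 3 + pos (u.2 x - v.2 x) ^+ 3) /\
    pos (u.2 x - v.2 x) ^+ 2 * (bracket_s P t u x - bracket_s P t v x) <=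
      C * (pos (u.2 x - v.2 x) ^+ 3 + pos (u.1 x - v.1 x) ^+ 3)}.
Proof.
move=> M0.
have [K K0 fK] := forcing_bounded.
have [La La0 LaP] := nondecreasing_W1py_lipschitz beta_a_W beta_a_nd.
have [Ls Ls0 LsP] := nondecreasing_W1py_lipschitz beta_s_W beta_s_nd.
pose C0 := lambda P + 4 * M ^+ 3 * (eps_a P * sigma_B P).
have c0 : 0 <= eps_a P * sigma_B P by rewrite mulr_ge0// ltW.
have C00 : 0 <= C0 by rewrite addr_ge0// mulr_ge0// mulr_ge0// exprn_ge0.
exists (C0 + K * (La + Ls)); first by rewrite addr_ge0// mulr_ge0// addr_ge0.
move=> t u v t0 bnd; have aeF := ae_filter_ringOfSetsType mu.
apply: filterS (fK t t0) => x fx Ix; have kK := fx Ix.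
have [u1M v1M u2M v2M] := bnd x Ix.
have d2 : 0 <= 2 * eps_a P * sigma_B P by rewrite -mulrA mulr_ge0.
have p1 := pos_ge0 (u.1 x - v.1 x) 3; have p2 := pos_ge0 (u.2 x - v.2 x) 3.
have weaken (L a b : R) : 0 <= L -> L <= La + Ls -> 0 <= a -> 0 <= b ->
    (C0 + K * L) * (a + b) <= (C0 + K * (La + Ls)) * (a + b).
  by move=> L0 LL pp qq; rewrite ler_wpM2r ?addr_ge0// lerD2l ler_wpM2l.
split.
- apply: le_trans (weaken La _ _ La0 _ p1 p2); last by rewrite lerDl.
  have := reaction_cooperative lambda_ge0 c0 d2 kK La0 LaP u1M v1M u2M v2M.
  congr (_ * _ <= _); rewrite /bracket_a; ring.
- apply: le_trans (weaken Ls _ _ Ls0 _ p2 p1); last by rewrite lerDr.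
  have := reaction_cooperative lambda_ge0 c0 (ltW sigma_B_gt0) kK Ls0 LsP u2M v2M u1M v1M.
  congr (_ * _ <= _); rewrite /bracket_s; ring.
Qed.

(** Gronwall's inequality for the weighted energies of the two components of X - Y. *)
Lemma sub_super_comparison (b1 b2 : \bar R) X Y :
  sub_solution P b1 X -> super_solution P b2 Y -> ble (X 0) (Y 0) ->
  forall t x, tint b1 t -> tint b2 t -> I x ->
    (X t).1 x <= (Y t).1 x /\ (X t).2 x <= (Y t).2 x.
Proof.
move=> [_ [C1Xa C1Xs DXa DXs] subX] [_ [C1Ya C1Ys DYa DYs] superY] [XY0a XY0s].
move=> T x0 b1T b2T Ix0; have [T0 _] := b1T.
have [Ma Ma0 XaM] := contDA_bounded DXa b1T; have [Ms Ms0 XsM] := contDA_bounded DXs b1T.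
have [Na Na0 YaM] := contDA_bounded DYa b2T; have [Ns Ns0 YsM] := contDA_bounded DYs b2T.
pose M := Ma + Ms + (Na + Ns).
have M0 : 0 <= M by rewrite !addr_ge0.
have [C C0 coop] := bracket_cooperative M0.
pose wa t (x : R) := (X t).1 x - (Y t).1 x; pose ws t (x : R) := (X t).2 x - (Y t).2 x.
have dXY (t : R) : tint b1 t -> tint b2 t ->
    dom (wa t) (fun x => Aop (X t).1 x - Aop (Y t).1 x) /\
    dom (ws t) (fun x => Aop (X t).2 x - Aop (Y t).2 x).
  move=> b1t b2t; have [A1 _ _] := DXa; have [A2 _ _] := DXs.
  have [A3 _ _] := DYa; have [A4 _ _] := DYs.
  by split; apply: domB; apply: mem_DA_dom; [exact: A1|exact: A3|exact: A2|exact: A4].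
have subtract (gam k p a p' a' B B' : R) : gam * (p - k * a) <= B ->
    B' <= gam * (p' - k * a') -> gam * ((p - p') - k * (a - a')) <= B - B' by lra.
pose Ea t := energy (wa t); pose Es t := energy (ws t).
pose E t := gamma_a P * Ea t + gamma_s P * Es t.
pose Va t (x : R) := tderiv (tint b1) (fst_c X) t x - tderiv (tint b2) (fst_c Y) t x.
pose Vs t (x : R) := tderiv (tint b1) (snd_c X) t x - tderiv (tint b2) (snd_c Y) t x.
pose Ja t := \int[mu]_(x in I) (pos (wa t x) ^+ 2 * Va t x).
pose Js t := \int[mu]_(x in I) (pos (ws t x) ^+ 2 * Vs t x).
have dissip (t : R) : 0 < t < T -> gamma_a P * Ja t <= C * (Ea t + Es t) /\
    gamma_s P * Js t <= C * (Es t + Ea t).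
  move=> /andP[t0 tT]; have b1t := tint_le b1T (ltW t0) (ltW tT).
  have b2t := tint_le b2T (ltW t0) (ltW tT).
  have [da ds] := dXY t b1t b2t.
  have [mXa _] := tderiv_eps C1Xa b1t; have [mXs _] := tderiv_eps C1Xs b1t.
  have [mYa _] := tderiv_eps C1Ya b2t; have [mYs _] := tderiv_eps C1Ys b2t.
  have [subXa subXs] := subX _ b1t; have [superYa superYs] := superY _ b2t.
  have aeF := ae_filter_ringOfSetsType mu.
  have bnd x : I x -> [/\ `|(X t).1 x| <= M, `|(Y t).1 x| <= M, `|(X t).2 x| <= M & `|(Y t).2 x| <= M].
    move=> Ix; have tT' : 0 <= t <= T by rewrite !ltW.
    have := XaM _ _ tT' Ix; have := XsM _ _ tT' Ix.
    have := YaM _ _ tT' Ix; have := YsM _ _ tT' Ix.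
    rewrite /fst_c /snd_c /M => h1 h2 h3 h4; split; lra.
  have co := coop t (X t) (Y t) t0 bnd.
  split.
  - apply: parabolic_estimate (ltW gamma_a_gt0) (ltW kappa_a_gt0) da ds (memHB mXa mYa) _.
    apply: filterS3 subXa superYa co => x h1 h2 h3 Ix.
    have [h _] := h3 Ix; apply: le_trans h; rewrite ler_wpM2l ?pos_ge0//.
    exact: subtract (h1 Ix) (h2 Ix).
  - apply: parabolic_estimate (ltW gamma_s_gt0) (ltW kappa_s_gt0) ds da (memHB mXs mYs) _.
    apply: filterS3 subXs superYs co => x h1 h2 h3 Ix.
    have [_ h] := h3 Ix; apply: le_trans h; rewrite ler_wpM2l ?pos_ge0//.
    exact: subtract (h1 Ix) (h2 Ix).
(* Ea + Es <= E / m *)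
pose m := Num.min (gamma_a P) (gamma_s P).
have m0 : 0 < m by rewrite lt_min gamma_a_gt0.
have ma : m <= gamma_a P by rewrite ge_min lexx.
have ms : m <= gamma_s P by rewrite ge_min lexx orbT.
have Ea0 t : 0 <= Ea t by exact: energy_ge0.
have Es0 t : 0 <= Es t by exact: energy_ge0.
have E0 : E 0 = 0.
  have [] := dXY 0; [by apply: tint_le b1T _ _|by apply: tint_le b2T _ _|].
  move=> da ds; have aeF := ae_filter_ringOfSetsType mu.
  rewrite /E /Ea /Es (energy_eq0 da) ?(energy_eq0 ds) ?mulr0 ?addr0//.
    by apply: filterS XY0s => x h Ix; rewrite /ws subr_le0; exact: h.
  by apply: filterS XY0a => x h Ix; rewrite /wa subr_le0; exact: h.
have ET : E T <= E 0 * expR (6 * C / m * T).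
  apply: (@gronwall _ E (fun t => gamma_a P * (3 * Ja t) + gamma_s P * (3 * Js t))) => //.
  - have ca := energy_diff_continuous DXa DYa b1T b2T.
    have cs := energy_diff_continuous DXs DYs b1T b2T.
    by move=> t; exact: cvgD (cvgM (cvg_cst _) (ca t)) (cvgM (cvg_cst _) (cs t)).
  - move=> t tT; have [ha hs] := dissip t tT.
    have da := energy_diff_is_derive C1Xa C1Ya DXa DYa b1T b2T tT.
    have ds := energy_diff_is_derive C1Xs C1Ys DXs DYs b1T b2T tT.
    split; first exact: is_deriveD (is_deriveZ (gamma_a P) da) (is_deriveZ (gamma_s P) ds).
    apply: (@le_trans _ _ (6 * C / m * (m * (Ea t + Es t)))).
      rewrite [leRHS]mulrA divfK ?gt_eqF//; clear - ha hs; lra.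
    rewrite ler_wpM2l//; first by rewrite divr_ge0 ?mulr_ge0// ltW.
    by rewrite mulrDr lerD// ler_wpM2r.
have ET0 : E T <= 0 by rewrite (le_trans ET)// E0 mul0r.
have := Ea0 T; have := Es0 T => EsT EaT.
have pa : 0 <= gamma_a P * Ea T by rewrite mulr_ge0// ltW.
have ps : 0 <= gamma_s P * Es T by rewrite mulr_ge0// ltW.
have [da ds] := dXY T b1T b2T.
split; rewrite -subr_le0.
- apply: (energy_le0 da) Ix0.
  rewrite -(pmulr_rle0 _ gamma_a_gt0); by apply: le_trans ET0; rewrite /E lerDl.
- apply: (energy_le0 ds) Ix0.
  rewrite -(pmulr_rle0 _ gamma_s_gt0); by apply: le_trans ET0; rewrite /E lerDr.
Qed.

Lemma strict_solution_sub_super (b : \bar R) T0 T : (0 < b)%E ->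
  strict_solution P (tint b) T0 T -> sub_solution P b T /\ super_solution P b T.
Proof.
move=> b0 [regT eqT _]; have aeF := ae_filter_ringOfSetsType mu.
have cancel (gam y a z : R) : 0 < gam -> y = a + gam^-1 * z -> gam * (y - a) = z.
  by move=> g0 ->; rewrite addrC addKr mulVKf// gt_eqF.
split; split => // t bt; have [eqa eqs] := eqT t bt; split.
- by apply: filterS eqa => x h Ix; rewrite (cancel _ _ _ _ gamma_a_gt0 (h Ix)).
- by apply: filterS eqs => x h Ix; rewrite (cancel _ _ _ _ gamma_s_gt0 (h Ix)).
- by apply: filterS eqa => x h Ix; rewrite (cancel _ _ _ _ gamma_a_gt0 (h Ix)).
- by apply: filterS eqs => x h Ix; rewrite (cancel _ _ _ _ gamma_s_gt0 (h Ix)).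
Qed.

End comparison.

Theorem theorem3p13 (R : realType) (P : ebm_data R) (theta0 : R)
  (T0 : (R -> R) * (R -> R)) (T : R -> (R -> R) * (R -> R)) (Tstar : \bar R)
  (gamma_a_gt0 : 0 < gamma_a P) (gamma_s_gt0 : 0 < gamma_s P)
  (kappa_a_gt0 : 0 < kappa_a P) (kappa_s_gt0 : 0 < kappa_s P)
  (sigma_B_gt0 : 0 < sigma_B P) (eps_a_gt0 : 0 < eps_a P)
  (lambda_ge0 : 0 <= lambda P)
  (beta_a_W : W1p setT +oo%E (beta_a P))
  (beta_s_W : W1p setT +oo%E (beta_s P))
  (beta_a_nd : {homo beta_a P : x y / x <= y})
  (beta_s_nd : {homo beta_s P : x y / x <= y})
  (theta0_in : 0 < theta0 < 1)
  (q_hoelder : loc_hoelder intI theta0 (q P))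
  (q_bounded : mem_Lp intI +oo%E (q P))
  (q_ge0 : forall x, intI x -> 0 <= q P x)
  (r_gt0 : forall t, 0 < t -> 0 < r P t)
  (r_bounded : [bounded r P t | t in [set t : R | 0 < t]])
  (r_lipschitz : [lipschitz r P t | t in [set t : R | 0 < t]])
  (T0_DA : bmem_DA T0)
  (T0_ge0 : ble (cst 0, cst 0) T0)
  (T_sol : maximal_strict_solution P Tstar T0 T) :
  (forall (b : \bar R) (Tp : R -> (R -> R) * (R -> R)),
     super_solution P b Tp -> ble T0 (Tp 0) ->
     forall t x, tint Tstar t -> tint b t -> intI x ->
       (T t).1 x <= (Tp t).1 x /\ (T t).2 x <= (Tp t).2 x)
  /\
  (forall (b : \bar R) (Tm : R -> (R -> R) * (R -> R)),
     sub_solution P b Tm -> ble (Tm 0) T0 ->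
     forall t x, tint Tstar t -> tint b t -> intI x ->
       (Tm t).1 x <= (T t).1 x /\ (Tm t).2 x <= (T t).2 x).
Proof.
have [b0 T_strict _] := T_sol; have [_ _ [T0a T0s]] := T_strict.
have [T_sub T_super] := strict_solution_sub_super gamma_a_gt0 gamma_s_gt0 b0 T_strict.
have aeF := ae_filter_ringOfSetsType (@lebesgue_measure R).
split=> [b Tp Tp_super [le_a le_s]|b Tm Tm_sub [le_a le_s]] t x tT tb Ix.
- apply: sub_super_comparison T_sub Tp_super _ _ _ tT tb Ix => //.
  by split; [apply: filterS2 T0a le_a|apply: filterS2 T0s le_s] => y e h Iy;
    rewrite e// h.
- apply: sub_super_comparison Tm_sub T_super _ _ _ tb tT Ix => //.
  by split; [apply: filterS2 T0a le_a|apply: filterS2 T0s le_s] => y e h Iy;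
    rewrite e// h.
Qed.
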